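(* If $X$ is a Banach space which has the Gaussian average property $\mathrm{GAP}$ and $X^*$ is of finite cotype, then $X$ is $K$-convex.
   Context: $\pi_1$ denotes the 1-summing norm. $\ell_2\otimes X$ is identified with the finite rank operators from $\ell_2$ to $X$. $(g_n)$ is a sequence of independent standard Gaussian variables on a probability space $(\Omega,\mathcal{S},\mu)$ and $(e_n)$ is the unit vector basis of $\ell_2$. For $T\in \ell_2\otimes X$ the $\ell$-norm is $\ell(T)=\left(\int\|\sum_{n=1}^\infty g_n(t)Te_n\|^2d\mu(t)\right)^{1/2}$ (the series converges in $L_2(\mu,X)$). $X$ has $\mathrm{GAP}$ if there is a constant $K$ so that $\ell(T)\le K\pi_1(T^* )$ for all $T\in\ell_2\otimes X$. $X$ is $K$-convex if the projections $f\mapsto\sum_{j=1}^n g_j\int f g_j\,d\mu$ on $L_2(\mu,X)$ are bounded uniformly in $n$. *)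

(* Defs.v *)
From HB Require Import structures.
From mathcomp Require Import all_boot all_order all_algebra.
From mathcomp Require Import all_classical all_reals all_analysis.
From mathcomp Require Import ring lra.

Set Implicit Arguments.
Unset Strict Implicit.
Unset Printing Implicit Defensive.

Import Order.TTheory GRing.Theory Num.Theory.
Import numFieldNormedType.Exports.

Local Open Scope classical_set_scope.
Local Open Scope ring_scope.

Section bounded_operators.
Context {R : realType} (V W : normedModType R).

Definition bounded_linear (f : V -> W) : Prop :=
  linear f /\ exists M : R, forall x, `|f x| <= M * `|x|.

Definition bop_pred : {pred V -> W} := mem [set f : V -> W | bounded_linear f].

Record bop : Type := Bop { bop_fun :> V -> W ; _ : bop_fun \in bop_pred }.

HB.instance Definition _ := [isSub for bop_fun].
HB.instance Definition _ := [Choice of bop by <:].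

Lemma bopP (f : bop) : bounded_linear f.
Proof. by case: f => f /= /set_mem. Qed.

Lemma bop_is_linear (f : bop) : linear f.
Proof. by have [] := bopP f. Qed.

HB.instance Definition _ (f : bop) :=
  GRing.isLinear.Build R V W *:%R f (bop_is_linear f).

Lemma bop_submod_closed : submod_closed bop_pred.
Proof.
have E0 x : (0 : V -> W) x = 0 by [].
have ED (f g : V -> W) x : (f + g) x = f x + g x by [].
have EZ (a : R) (f : V -> W) x : (a *: f) x = a *: f x by [].
split.
  apply/mem_set; split; first by move=> a x y; rewrite !E0 scaler0 addr0.
  by exists 0 => x; rewrite E0 normr0 mul0r.
move=> a f g /set_mem[lf [M fM]] /set_mem[lg [N gN]]; apply/mem_set; split.
  move=> b x y; rewrite !(ED, EZ) lf lg !scalerDr !scalerA (mulrC a b).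
  by rewrite addrACA.
exists (`|a| * M + N) => x; rewrite !(ED, EZ) (le_trans (ler_normD _ _))//.
by rewrite normrZ mulrDl lerD// -mulrA ler_wpM2l.
Qed.

HB.instance Definition _ :=
  GRing.isSubmodClosed.Build _ _ bop_pred bop_submod_closed.
HB.instance Definition _ := [SubChoice_isSubLmodule of bop by <:].

Lemma bopDE (f g : bop) x : (f + g) x = f x + g x. Proof. by []. Qed.
Lemma bopZE (a : R) (f : bop) x : (a *: f) x = a *: f x. Proof. by []. Qed.

Definition bop_norm (f : bop) : R :=
  sup [set `|f x| | x in [set x : V | `|x| <= 1]].

Lemma bop_has_sup (f : bop) :
  has_sup [set `|f x| | x in [set x : V | `|x| <= 1]].
Proof.
split; first by exists `|f 0|, 0 => //=; rewrite normr0 ler01.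
have [_ [M fM]] := bopP f; exists `|M| => _ [x /= x1 <-].
rewrite (le_trans (fM x))// (le_trans (ler_norm _))// normrM normr_id.
by rewrite ler_piMr.
Qed.

Lemma bop_norm_ub (f : bop) x : `|x| <= 1 -> `|f x| <= bop_norm f.
Proof.
by move=> x1; apply: sup_upper_bound; [exact: bop_has_sup|exists x].
Qed.

Lemma bop_norm_le (f : bop) M :
  (forall x, `|x| <= 1 -> `|f x| <= M) -> bop_norm f <= M.
Proof.
move=> fM; apply: ge_sup; first by have [] := bop_has_sup f.
by move=> _ [x /= /fM ? <-].
Qed.

Lemma bop_normP (f : bop) x : `|f x| <= bop_norm f * `|x|.
Proof.
have [->|x0] := eqVneq x 0; first by rewrite linear0 !normr0 mulr0.
have nx0 : 0 < `|x| by rewrite normr_gt0.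
have := @bop_norm_ub f (`|x|^-1 *: x).
rewrite linearZ/= !normrZ ger0_norm ?invr_ge0// mulVf ?gt_eqF// => /(_ (lexx _)).
by rewrite mulrC ler_pdivrMr.
Qed.

Lemma ler_bop_normD (f g : bop) : bop_norm (f + g) <= bop_norm f + bop_norm g.
Proof.
apply: bop_norm_le => x x1; rewrite bopDE (le_trans (ler_normD _ _))//.
by rewrite lerD// bop_norm_ub.
Qed.

Lemma bop_normZ (a : R) (f : bop) : bop_norm (a *: f) = `|a| * bop_norm f.
Proof.
have le_normZ (b : R) (h : bop) : bop_norm (b *: h) <= `|b| * bop_norm h.
  by apply: bop_norm_le => x x1; rewrite bopZE normrZ ler_wpM2l ?bop_norm_ub.
apply/eqP; rewrite eq_le le_normZ/=.
have [->|a0] := eqVneq a 0.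
  rewrite normr0 mul0r (le_trans _ (@bop_norm_ub (0 *: f) 0 _))//.
  by rewrite normr0 ler01.
have := le_normZ a^-1 (a *: f); rewrite scalerA mulVf// scale1r normfV.
by rewrite mulrC ler_pdivlMr ?normr_gt0// mulrC.
Qed.

Lemma bop_norm0_eq0 (f : bop) : bop_norm f = 0 -> f = 0.
Proof.
move=> f0; apply/val_inj/funext => x /=; apply/eqP; rewrite -normr_le0.
by rewrite (le_trans (bop_normP f x))// f0 mul0r.
Qed.

HB.instance Definition _ := Lmodule_isNormed.Build R bop
  ler_bop_normD bop_normZ bop_norm0_eq0.

End bounded_operators.

Definition dual {R : realType} (V : normedModType R) : Type := bop V R^o.
Identity Coercion bop_of_dual : dual >-> bop.
HB.instance Definition _ (R : realType) (V : normedModType R) :=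
  NormedModule.on (dual V).

Section adjoint.
Context {R : realType} {V W : normedModType R}.

Lemma adjoint_subproof (T : bop V W) (phi : dual W) :
  (phi \o T : V -> R^o) \in @bop_pred R V R^o.
Proof.
apply/mem_set; split; first by move=> a x y /=; rewrite !linearP.
exists (bop_norm phi * bop_norm T) => x /=.
rewrite (le_trans (bop_normP phi _))// -mulrA ler_wpM2l ?bop_normP//.
by rewrite (le_trans _ (@bop_norm_ub _ _ _ phi 0 _)) ?normr0 ?ler01.
Qed.

Definition adjoint (T : bop V W) (phi : dual W) : dual V :=
  Bop (adjoint_subproof T phi).

End adjoint.

Section ell2.
Context {R : realType}.

Definition sqsum (x : nat -> R) : R^nat := series (fun n => x n ^+ 2).

Definition ell2_pred : {pred nat -> R} := mem [set x | cvgn (sqsum x)].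

Record ell2 : Type := Ell2 { ell2_seq :> nat -> R ; _ : ell2_seq \in ell2_pred }.

HB.instance Definition _ := [isSub for ell2_seq].
HB.instance Definition _ := [Choice of ell2 by <:].

Definition ell2_norm (x : nat -> R) : R := Num.sqrt (limn (sqsum x)).

Lemma ndseq_sqsum x : nondecreasing_seq (sqsum x).
Proof.
by apply/nondecreasing_seqP => n; rewrite /sqsum seriesSr lerDl sqr_ge0.
Qed.

Lemma sqsum_ub x M : (forall n, sqsum x n <= M) -> cvgn (sqsum x).
Proof.
move=> xM; apply: nondecreasing_is_cvgn; first exact: ndseq_sqsum.
by exists M => _ [n _ <-].
Qed.

Lemma sqsum_le_lim x n : cvgn (sqsum x) -> sqsum x n <= limn (sqsum x).
Proof. by move=> cx; apply: nondecreasing_cvgn_le => //; exact: ndseq_sqsum. Qed.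

Lemma sqsum_ge0 x n : 0 <= sqsum x n.
Proof. by rewrite /sqsum seriesEnat/= sumr_ge0// => i _; rewrite sqr_ge0. Qed.

Lemma lim_sqsum_ge0 x : cvgn (sqsum x) -> 0 <= limn (sqsum x).
Proof. by move=> cx; rewrite (le_trans (sqsum_ge0 x 0))// sqsum_le_lim. Qed.

Lemma sqr_ell2_norm x : cvgn (sqsum x) -> ell2_norm x ^+ 2 = limn (sqsum x).
Proof. by move=> cx; rewrite sqr_sqrtr// lim_sqsum_ge0. Qed.

Lemma ell2_norm_eq0 x n : cvgn (sqsum x) -> ell2_norm x = 0 -> x n = 0.
Proof.
move=> cx x0; apply/eqP; rewrite -sqrf_eq0 eq_le sqr_ge0 andbT.
have := sqsum_le_lim n.+1 cx; rewrite -sqr_ell2_norm// x0 expr0n/=.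
rewrite /sqsum seriesSr; apply: le_trans.
by rewrite lerDr; exact: sqsum_ge0.
Qed.

Lemma sqsumD_le x y n : cvgn (sqsum x) -> cvgn (sqsum y) ->
  sqsum (x \+ y) n <= (ell2_norm x + ell2_norm y) ^+ 2.
Proof.
move=> cx cy.
have a0 : 0 <= ell2_norm x by exact: sqrtr_ge0.
have b0 : 0 <= ell2_norm y by exact: sqrtr_ge0.
have Ax := sqsum_le_lim n cx; have By := sqsum_le_lim n cy.
rewrite -sqr_ell2_norm// in Ax; rewrite -sqr_ell2_norm// in By.
have [xeq0|x_neq0] := eqVneq (ell2_norm x) 0.
  rewrite xeq0 add0r (_ : x \+ y = y)//.
  by apply/funext => k /=; rewrite (ell2_norm_eq0 k cx)// add0r.
have [yeq0|y_neq0] := eqVneq (ell2_norm y) 0.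
  rewrite yeq0 addr0 (_ : x \+ y = x)//.
  by apply/funext => k /=; rewrite (ell2_norm_eq0 k cy)// addr0.
have {x_neq0}a_gt0 : 0 < ell2_norm x by rewrite lt_neqAle eq_sym x_neq0.
have {y_neq0}b_gt0 : 0 < ell2_norm y by rewrite lt_neqAle eq_sym y_neq0.
move: (ell2_norm x) (ell2_norm y) a0 b0 a_gt0 b_gt0 Ax By.
move=> a b _ _ a0 b0 Ax By.
have step : sqsum (x \+ y) n <=
    (a + b) * (a^-1 * sqsum x n + b^-1 * sqsum y n).
  rewrite /sqsum !seriesEnat/= !mulr_sumr -big_split/= mulr_sumr.
  apply: ler_sum => k _; set u := x k; set v := y k.
  have ab0 : 0 < a * b by rewrite mulr_gt0.
  rewrite -(ler_pM2l ab0).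
  have -> : a * b * ((a + b) * (a^-1 * u ^+ 2 + b^-1 * v ^+ 2)) =
      (a + b) * (b * u ^+ 2 + a * v ^+ 2) by field; rewrite !gt_eqF.
  by rewrite -subr_ge0 (_ : _ - _ = (b * u - a * v) ^+ 2) ?sqr_ge0//; ring.
apply: (le_trans step); rewrite expr2 ler_pM2l ?addr_gt0// lerD//.
  by rewrite mulrC ler_pdivrMr// -expr2.
by rewrite mulrC ler_pdivrMr// -expr2.
Qed.

Lemma sqsumZ a x : sqsum (fun n => a * x n) = a ^+ 2 *: sqsum x.
Proof.
apply/funext => n; rewrite /sqsum [RHS]/= seriesEnat/= [in RHS]seriesEnat.
by rewrite [RHS]mulr_sumr; apply: eq_bigr => k _; rewrite exprMn.
Qed.

Lemma ell2_submod_closed : submod_closed ell2_pred.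
Proof.
split.
  apply/mem_set; apply: (@sqsum_ub _ 0) => n; rewrite /sqsum seriesEnat/=.
  by rewrite big1// => i _; rewrite expr0n.
move=> a x y /set_mem/= cx /set_mem/= cy; apply/mem_set.
apply: (sqsum_ub (M := (ell2_norm (a *: x) + ell2_norm y) ^+ 2)) => n.
apply: sqsumD_le => //; rewrite [X in cvgn X](_ : _ = a ^+ 2 *: sqsum x).
  exact: is_cvgZr.
exact: sqsumZ.
Qed.

HB.instance Definition _ :=
  GRing.isSubmodClosed.Build _ _ ell2_pred ell2_submod_closed.
HB.instance Definition _ := [SubChoice_isSubLmodule of ell2 by <:].

Lemma ell2P (x : ell2) : cvgn (sqsum x).
Proof. by case: x => x /= /set_mem. Qed.

Lemma ler_ell2_normD (x y : ell2) :
  ell2_norm (x + y : ell2) <= ell2_norm x + ell2_norm y.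
Proof.
rewrite -(@ger0_norm _ (ell2_norm x + _)) ?addr_ge0 ?sqrtr_ge0//.
rewrite -sqrtr_sqr ler_wsqrtr//; apply: limr_le; first exact: ell2P.
by near=> n; apply: (@sqsumD_le (x : nat -> R) y); exact: ell2P.
Unshelve. all: by end_near. Qed.

Lemma ell2_normZ (a : R) (x : ell2) : ell2_norm (a *: x : ell2) = `|a| * ell2_norm x.
Proof.
rewrite /ell2_norm (_ : sqsum _ = a ^+ 2 *: sqsum x); last exact: sqsumZ.
rewrite limZr; last exact: ell2P.
by rewrite sqrtrM ?sqr_ge0// sqrtr_sqr.
Qed.

Lemma ell2_norm0_eq0 (x : ell2) : ell2_norm x = 0 -> x = 0.
Proof.
move=> x0; apply/val_inj/funext => n /=.
by rewrite (@ell2_norm_eq0 x)//; exact: ell2P.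
Qed.

HB.instance Definition _ := Lmodule_isNormed.Build R ell2
  ler_ell2_normD ell2_normZ ell2_norm0_eq0.

Lemma ell2_basis_subproof (n : nat) :
  (fun k => (k == n)%:R : R) \in ell2_pred.
Proof.
apply/mem_set; apply: (@sqsum_ub _ 1) => m; rewrite /sqsum seriesEnat/=.
have -> : \sum_(0 <= k < m) ((k == n)%:R : R) ^+ 2 = (n < m)%:R.
  elim: m => [|m IH]; first by rewrite big_geq.
  rewrite big_nat_recr//= IH ltnS.
  by case: (ltngtP m n) => //= _; rewrite ?expr0n ?expr1n ?addr0 ?add0r.
by case: (n < m)%N; rewrite ?ler01.
Qed.

Definition ell2_basis (n : nat) : ell2 := Ell2 (ell2_basis_subproof n).

End ell2.
Arguments ell2 : clear implicits.

Definition finite_rank {R : realType} {V W : normedModType R} (T : V -> W) :=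
  exists (m : nat) (w : 'I_m -> W),
    forall x, exists c : 'I_m -> R, T x = \sum_(i < m) c i *: w i.

Section summing_norm.
Context {R : realType} {V W : normedModType R}.

Definition weak_l1_norm n (x : 'I_n -> V) : \bar R :=
  ereal_sup [set (\sum_(i < n) `|phi (x i)|)%:E |
             phi in [set phi : dual V | `|phi| <= 1]].

Definition pi1_norm (u : V -> W) : \bar R :=
  ereal_inf [set C%:E | C in [set C : R | 0 <= C /\
    forall n (x : 'I_n -> V),
      ((\sum_(i < n) `|u (x i)|)%:E <= C%:E * weak_l1_norm x)%E]].

End summing_norm.

Section cotype.
Context {R : realType} (V : normedModType R).

(* The Rademacher functions r_1, ..., r_n take each sign pattern with
   probability 2 ^ - n, so integrals of functions of them are finite means. *)
Definition rademacher_L2 n (x : 'I_n -> V) : R :=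
  Num.sqrt (2 ^- n *
    \sum_(eps : {ffun 'I_n -> bool}) `|\sum_(i < n) (-1) ^+ eps i *: x i| ^+ 2).

Definition has_cotype (q : R) : Prop :=
  exists C : R, forall n (x : 'I_n -> V),
    (\sum_(i < n) `|x i| `^ q) `^ q^-1 <= C * rademacher_L2 x.

Definition finite_cotype : Prop := exists2 q : R, 2 <= q & has_cotype q.

End cotype.

Section bochner.
Context {R : realType} {d : measure_display} {Omega : measurableType d}.
Context (P : probability Omega R) {X : normedModType R}.
Implicit Types f s : Omega -> X.

Definition simple_fun s : Prop :=
  finite_set (range s) /\ forall x : X, measurable (s @^-1` [set x]).

(* Every class of L_2(P, X) has a representative that is an everywhere
   pointwise limit of simple functions; only such functions are considered. *)
Definition strongly_measurable f : Prop :=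
  exists s : nat -> Omega -> X,
    (forall n, simple_fun (s n)) /\ forall t, s n t @[n --> \oo] --> f t.

Definition simple_integral s : X :=
  \sum_(x \in range s) fine (P (s @^-1` [set x])) *: x.

Definition has_bochner_integral f (v : X) : Prop :=
  strongly_measurable f /\
  exists s : nat -> Omega -> X,
    [/\ forall n, simple_fun (s n),
        (\int[P]_t (`|f t - s n t|)%:E)%E @[n --> \oo] --> 0%E &
        simple_integral (s n) @[n --> \oo] --> v].

Definition bochner_integral f : X := xget 0 (has_bochner_integral f).

Definition L2_norm f : \bar R := ('N[P]_2%:E[(fun t => (`|f t|)%:E)])%E.

Definition L2 : set (Omega -> X) :=
  [set f | strongly_measurable f /\ (L2_norm f < +oo)%E].

End bochner.

Section gaussian.
Context {R : realType} {d : measure_display} {Omega : measurableType d}.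
Context {P : probability Omega R}.

Definition independent (g : nat -> {RV P >-> R}) : Prop :=
  forall (J : seq nat) (B : nat -> set R), uniq J ->
    (forall j, measurable (B j)) ->
    P (\bigcap_(j in [set` J]) (g j @^-1` B j)) =
    (\prod_(j <- J) P (g j @^-1` B j))%E.

Definition standard_gaussian (X : {RV P >-> R}) : Prop :=
  forall B : set R, measurable B -> distribution P X B = normal_prob 0 1 B.

Definition gaussian_sequence (g : nat -> {RV P >-> R}) : Prop :=
  independent g /\ forall n, standard_gaussian (g n).

Context (g : nat -> {RV P >-> R}) (X : normedModType R).

Definition is_gaussian_series (T : bop (ell2 R) X) (h : Omega -> X) : Prop :=
  L2 P h /\
  L2_norm P (fun t => h t - \sum_(j < n) g j t *: T (ell2_basis j))
    @[n --> \oo] --> 0%E.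

Definition gaussian_series (T : bop (ell2 R) X) : Omega -> X :=
  xget (cst 0) (is_gaussian_series T).

Definition ell_norm (T : bop (ell2 R) X) : \bar R :=
  L2_norm P (gaussian_series T).

(* The adjoint takes values in the dual of [ell2 R], which is isometric to
   [ell2 R] itself. *)
Definition GAP : Prop :=
  exists K : R, forall T : bop (ell2 R) X, finite_rank T ->
    (ell_norm T <= K%:E * pi1_norm (adjoint T))%E.

Definition gaussian_projection (n : nat) (f : Omega -> X) : Omega -> X :=
  fun t => \sum_(j < n) g j t *: bochner_integral P (fun s => g j s *: f s).

Definition K_convex : Prop :=
  exists C : R, forall (n : nat) (f : Omega -> X), L2 P f ->
    (L2_norm P (gaussian_projection n f) <= C%:E * L2_norm P f)%E.

End gaussian.

(* Main.v *)
Require Import Defs.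
From HB Require Import structures.
From mathcomp Require Import all_boot all_order all_algebra finmap.
From mathcomp Require Import all_classical all_reals all_analysis.
From mathcomp Require Import measurable_realfun ring lra.

(* Fix f in L_2(X), let x_j = E[g_j f] and let T : l_2 -> X send e_j to x_j for
   j < n. By GAP it is enough to bound pi_1(T^* ) by a multiple of ||f||_2. Given
   phi_1, ..., phi_N in X^* with ||sum_k y_k phi_k|| <= 1 whenever |y_k| <= 1,
   and a^k in the unit ball of l_2 almost norming T^* phi_k,
     sum_k ||T^* phi_k|| ~ E[sum_k G_k phi_k(f)], where G_k = sum_j a^k_j g_j,
   so one needs a domination of y |-> sum_k y_k phi_k that only involves moments
   of the single coordinates y_k. Cotype q of X^* makes this map
   (q,1)-summing on l_infty^N, and Pisier's extremal argument yields weights mu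
   of total mass independent of N with
     |sum_k y_k phi_k(z)|^q <= sum_k mu_k |y_k|   if |y_k| <= 1 and ||z|| <= 1.
   Cutting y into dyadic layers gives
     |sum_k y_k phi_k(z)|^2 <= c (1 + sum_k mu_k |y_k|^(2q))   for all y,
   and the moments of the G_k are bounded uniformly. *)

Set Implicit Arguments.
Unset Strict Implicit.
Unset Printing Implicit Defensive.

Import Order.TTheory GRing.Theory Num.Theory.
Import numFieldNormedType.Exports.

Local Open Scope classical_set_scope.
Local Open Scope ring_scope.

(** * Tangent-line inequality for powers *)

Lemma expr_tangent_ge0 (R : realFieldType) (q : nat) (a c : R) :
  0 <= a -> 0 <= c ->
  a ^+ q.+1 + q.+1%:R * (a ^+ q * (c - a)) <= c ^+ q.+1.
Proof.
move=> a0 c0; elim: q => [|q IH]; first by rewrite !expr1 expr0; lra.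
(* The induction hypothesis multiplied by [c] exceeds what is needed on the left by (q+1) a^q (a -
   c)^2. *)
have {}IH := ler_wpM2l c0 IH.
rewrite exprS [_ ^+ q.+2 in leRHS]exprS; apply: le_trans IH.
rewrite -subr_ge0 [leRHS](_ : _ = q.+1%:R * (a ^+ q * (a - c) ^+ 2)).
  by rewrite mulr_ge0 ?ler0n// mulr_ge0 ?sqr_ge0// exprn_ge0.
rewrite -[q.+2%:R]natr1 !exprS; ring.
Qed.

(** As q+1 is even, replacing a and c by their absolute values changes only the mixed term a^q c,
    and can only increase it. *)
Lemma expr_tangent_even (R : realFieldType) (q : nat) (a c : R) :
  odd q -> a ^+ q.+1 + q.+1%:R * (a ^+ q * (c - a)) <= c ^+ q.+1.
Proof.
move=> oq; have eq : ~~ odd q.+1 by rewrite /= oq.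
have e x : `|x : R| ^+ q.+1 = x ^+ q.+1 by rewrite -normrX ger0_norm ?exprn_even_ge0.
rewrite -(e c) -(e a); apply: le_trans (expr_tangent_ge0 q (normr_ge0 a) (normr_ge0 c)).
rewrite lerD2l ler_wpM2l// !mulrBr -!exprSr e lerB// -normrX -normrM.
exact: ler_norm.
Qed.

(** * Pisier domination in finite dimension *)

Section domination.
Context {R : realType} {N : nat} {Z : Type} (b : 'I_N -> Z -> R).
Implicit Types (x : 'I_N -> R) (z : Z).

(** In the application [b k z] is the value of a functional phi_k at a point z of the unit ball of
    X. *)
Definition pairing x z : R := \sum_(k < N) x k * b k z.

Lemma pairingB x y z :
  pairing (fun k => x k - y k) z = pairing x z - pairing y z.
Proof. by rewrite /pairing -sumrB; apply: eq_bigr => k _; rewrite mulrBl. Qed.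

Lemma pairingZ (c : R) x z : pairing (fun k => c * x k) z = c * pairing x z.
Proof. by rewrite /pairing mulr_sumr; apply: eq_bigr => k _; rewrite mulrA. Qed.

(** The hypothesis on [s] says that its vectors have weak l_1 norm at most 1 in l_infty^N. Each
    vector is paired with a point of its own, so for even [q] this is the (q,1)-summing property of
    x |-> sum_k x_k b_k for the sup norm over [Z]. *)
Definition power_summing (q : nat) (D : R) : Prop :=
  forall s : seq (('I_N -> R) * Z), (forall k, \sum_(p <- s) `|p.1 k| <= 1) ->
  \sum_(p <- s) pairing p.1 p.2 ^+ q <= D.

(** The supremum of the q+1 power sums over admissible families need not be attained; a family
    within [delta] of it serves instead, at the cost of the additive [delta]. *)
Lemma power_summing_near_domination q (D delta : R) : odd q ->
  power_summing q.+1 D -> 0 < delta ->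
  exists mu : 'I_N -> R, [/\ forall k, 0 <= mu k,
    \sum_(k < N) mu k <= q.+1%:R * (2 * D) &
    forall x z, (forall k, `|x k| <= 1) ->
      pairing x z ^+ q.+1 <= \sum_(k < N) mu k * `|x k| + delta].
Proof.
move=> oq sD delta0; have eq : ~~ odd q.+1 by rewrite /= oq.
pose adm (s : seq (('I_N -> R) * Z)) :=
  forall k, \sum_(p <- s) `|p.1 k| <= 1.
pose F (s : seq (('I_N -> R) * Z)) := \sum_(p <- s) pairing p.1 p.2 ^+ q.+1.
pose S := [set F s | s in adm].
have hS : has_sup S.
  split; first by exists (F [::]), [::] => // k; rewrite big_nil.
  by exists D => _ [s /sD ? <-].
have [_ [s sadm <-] sS] := sup_adherent delta0 hS.
have FS t : adm t -> F t <= sup S by move=> ta; apply: sup_upper_bound; [|exists t].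
pose a p := pairing p.1 p.2 ^+ q.
(* [nu k] is the derivative of [F] at [s] when the k-th coordinates of all vectors of [s] are
   rescaled together; [nuE] is the derivative in direction [h]. *)
pose nu k := q.+1%:R * \sum_(p <- s) a p * (p.1 k * b k p.2).
have nuE h : \sum_(k < N) nu k * h k =
    q.+1%:R * \sum_(p <- s) a p * pairing (fun k => h k * p.1 k) p.2.
  rewrite mulr_sumr; under eq_bigr do rewrite /nu -mulrA mulr_suml mulr_sumr.
  rewrite exchange_big/=; apply: eq_bigr => p _.
  rewrite /pairing !mulr_sumr; apply: eq_bigr => k _; ring.
exists (fun k => `|nu k|); split => [k//||x z x1].
  have -> : \sum_(k < N) `|nu k| = \sum_(k < N) nu k * Num.sg (nu k).
    by apply: eq_bigr => k _; rewrite mulrC -normrEsg.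
  rewrite nuE ler_wpM2l// mulr_natl mulr2n.
  (* The total mass is the derivative in direction sgn(nu). Multiplying coordinates by these signs
     keeps the family admissible, and |u|^q |v| <= u^(q+1) + v^(q+1) bounds each term by one from
     [s] and one from [t], whence 2D. *)
  set t := [seq ((fun k => Num.sg (nu k) * p.1 k), p.2) | p <- s].
  have tadm : adm t.
    move=> k; rewrite big_map; apply: le_trans (sadm k); apply: ler_sum => p _ /=.
    by rewrite normrM ler_piMl// normr_sg lern1 leq_b1.
  have := lerD (sD _ sadm) (sD _ tadm); apply: le_trans.
  rewrite big_map -big_split/=; apply: ler_sum => p _.
  rewrite /a; set u := pairing _ _; set v := pairing _ _.
  rewrite -(@ger0_norm _ (u ^+ q.+1)) ?exprn_even_ge0//.
  rewrite -(@ger0_norm _ (v ^+ q.+1)) ?exprn_even_ge0// !normrX.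
  apply: le_trans (ler_norm _) _; rewrite normrM normrX.
  have [uv|/ltW vu] := leP `|u| `|v|.
    rewrite (@le_trans _ _ (`|v| ^+ q.+1))//; last by rewrite lerDr exprn_ge0.
    by rewrite exprSr ler_pM ?exprn_ge0// lerXn2r ?nnegrE.
  rewrite (@le_trans _ _ (`|u| ^+ q.+1))//; last by rewrite lerDl exprn_ge0.
  by rewrite exprSr ler_pM ?exprn_ge0.
(* Pisier's argument: shrinking the near-extremal family s by the factor 1 - |x|
   makes room for (x, z), whose contribution is thus at most the loss incurred,
   which convexity bounds linearly in |x|. *)
pose t := (x, z) :: [seq ((fun k => (1 - `|x k|) * p.1 k), p.2) | p <- s].
have tadm : adm t.
  move=> k; rewrite big_cons big_map/=.
  have -> : \sum_(p <- s) `|(1 - `|x k|) * p.1 k| =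
      (1 - `|x k|) * \sum_(p <- s) `|p.1 k|.
    rewrite mulr_sumr; apply: eq_bigr => p _.
    by rewrite normrM ger0_norm// subr_ge0.
  have := ler_wpM2l (_ : 0 <= 1 - `|x k|) (sadm k).
  by rewrite subr_ge0 x1 => /(_ isT); lra.
have := le_lt_trans (FS _ tadm) (_ : _ < F s + delta).
rewrite -ltrBlDr sS => /(_ isT) /ltW; rewrite {1}/F big_cons big_map/= => H.
have : F s - q.+1%:R * \sum_(p <- s) a p * pairing (fun k => `|x k| * p.1 k) p.2 <=
   \sum_(p <- s) pairing (fun k => (1 - `|x k|) * p.1 k) p.2 ^+ q.+1.
  rewrite /F mulr_sumr -sumrB; apply: ler_sum => p _.
  have -> : pairing (fun k => (1 - `|x k|) * p.1 k) p.2 =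
      pairing p.1 p.2 - pairing (fun k => `|x k| * p.1 k) p.2.
    by rewrite -pairingB; congr pairing; apply/funext => k; rewrite mulrBl mul1r.
  set u := pairing _ _; set v := pairing _ _.
  by have := @expr_tangent_even R q u (u - v) oq; rewrite /a; lra.
rewrite -nuE => H2.
have : \sum_(k < N) nu k * `|x k| <= \sum_(k < N) `|nu k| * `|x k|.
  by apply: ler_sum => k _; rewrite ler_wpM2r// ler_norm.
lra.
Qed.

(** The additive error is chosen as 1/(N+1) and then added to each of the N weights, so the total
    mass grows by at most 1, independently of N. *)
Lemma power_summing_domination q D : odd q -> power_summing q.+1 D ->
  exists mu : 'I_N -> R, [/\ forall k, 0 <= mu k,
    \sum_(k < N) mu k <= q.+1%:R * (2 * D) + 1 &
    forall x z, (forall k, `|x k| <= 1) ->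
      pairing x z ^+ q.+1 <= \sum_(k < N) mu k * `|x k|].
Proof.
move=> oq sD; pose dl : R := N.+1%:R^-1.
have dl0 : 0 < dl by rewrite invr_gt0.
have [mu [mu0 smu muD]] := power_summing_near_domination oq sD dl0.
(* Rescaling x to sup-norm 1 turns the additive error dl into dl * max |x k|. *)
exists (fun k => mu k + dl); split => [k||x z x1].
- by rewrite addr_ge0// ltW.
- rewrite big_split/= lerD// sumr_const card_ord -mulr_natr mulrC.
  by rewrite ler_pdivrMr// mul1r ler_nat.
have [/forallP x0|] := boolP [forall k, x k == 0].
  rewrite {1}/pairing big1 ?expr0n//=; last by move=> k _; rewrite (eqP (x0 k)) mul0r.
  by apply: sumr_ge0 => k _; rewrite mulr_ge0// addr_ge0// ltW.
rewrite negb_forall => /existsP[k0 xk0].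
pose k1 := [arg max_(k > k0) `|x k|]%O; pose t := `|x k1|.
have xt k : `|x k| <= t.
  by rewrite /t /k1; case: Order.TotalTheory.arg_maxP => // i _; exact.
have t0 : 0 < t by rewrite (lt_le_trans _ (xt k0))// normr_gt0.
have : (t^-1 * pairing x z) ^+ q.+1 <=
    \sum_(k < N) mu k * `|t^-1 * x k| + dl.
  rewrite -pairingZ; apply: muD => k.
  by rewrite normrM normfV normr_id ler_pdivrMl// mulr1.
have -> : \sum_(k < N) mu k * `|t^-1 * x k| =
    t^-1 * \sum_(k < N) mu k * `|x k|.
  rewrite mulr_sumr; apply: eq_bigr => k _.
  by rewrite normrM normfV normr_id mulrCA.
set M := \sum_(k < N) mu k * `|x k|.
have M0 : 0 <= M by apply: sumr_ge0 => k _; rewrite mulr_ge0.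
rewrite exprMn exprVn ler_pdivrMl ?exprn_gt0// => H.
have -> : \sum_(k < N) (mu k + dl) * `|x k| = M + dl * \sum_(k < N) `|x k|.
  by rewrite mulr_sumr -big_split; apply: eq_bigr => k _; rewrite mulrDl.
(* t^(q+1) (M/t + dl) = t^q (M + t dl), where t <= 1 and t <= sum_k |x_k|. *)
apply: (le_trans H); rewrite exprSr -mulrA mulrDr mulrA divff ?gt_eqF// mul1r.
apply: (@le_trans _ _ (M + t * dl)).
  rewrite ler_piMl //; first by rewrite addr_ge0 // mulr_ge0 // ltW.
  by apply: exprn_ile1; [exact: ltW | exact: x1].
rewrite lerD2l mulrC; apply: ler_wpM2l; first exact: ltW.
by rewrite /t (bigD1 k1)//= lerDl sumr_ge0.
Qed.

(** Induction on [l] peels off the top layer of [x]. The part of size at most 1 contributes [a], the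
    layer above 2^i contributes B / 2^i, and 2 - 2 / 2^l is the sum of 2^-i over i < l. *)
Lemma dominated_dyadic q (mu : 'I_N -> R) (a B : R) (l : nat) x z :
  (0 < q)%N -> (forall k, 0 <= mu k) ->
  (forall x z, (forall k, `|x k| <= 1) ->
     `|pairing x z| ^+ q <= \sum_(k < N) mu k * `|x k|) ->
  0 <= a -> 0 <= B -> \sum_(k < N) mu k <= a ^+ q ->
  \sum_(k < N) mu k * `|x k| ^+ q.*2 <= B ^+ q ->
  (forall k, `|x k| <= 2 ^+ l) ->
  `|pairing x z| <= a + (2 - 2 / 2 ^+ l) * B.
Proof.
move=> q0 mu0 muP a0 B0 mua.
elim: l x => [|l IH] x xB xl.
  rewrite expr0 divr1 subrr mul0r addr0 -(@ler_pXn2r _ q) ?nnegrE//.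
  rewrite (le_trans (muP x z _))//; apply: le_trans mua; apply: ler_sum => k _.
  by rewrite ler_piMr// (le_trans (xl k)) ?expr0.
have p0 : 0 < 2 ^+ l :> R by rewrite exprn_gt0.
(* [x'] is [x] truncated at height 2^l with signs kept; the remainder [y] vanishes where |x_k| <=
   2^l. *)
pose x' k := Num.sg (x k) * Num.min `|x k| (2 ^+ l).
pose y k := x k - x' k.
have x'E k : `|x' k| = Num.min `|x k| (2 ^+ l).
  rewrite normrM normr_sg; have [->|x0] := eqVneq (x k) 0.
    by rewrite normr0 mul0r min_l// ltW.
  by rewrite mul1r ger0_norm// le_min normr_ge0 ltW.
have yE k : `|y k| = `|x k| - Num.min `|x k| (2 ^+ l).
  rewrite /y /x' {1}[x k]numEsg -mulrBr normrM normr_sg.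
  have [->|x0] := eqVneq (x k) 0; first by rewrite normr0 mul0r min_l ?subrr// ltW.
  by rewrite mul1r ger0_norm// subr_ge0 ge_min lexx.
have -> : pairing x z = pairing x' z + pairing y z by rewrite pairingB; ring.
have H1 : `|pairing x' z| <= a + (2 - 2 / 2 ^+ l) * B.
  apply: IH => [|k]; last by rewrite x'E ge_min lexx orbT.
  apply: le_trans xB; apply: ler_sum => k _; rewrite ler_wpM2l// lerXn2r ?nnegrE//.
  by rewrite x'E ge_min lexx.
(* With t = 2^l, the domination applies to y/t. One factor t^q undoes this scaling and another one
   pays for the gain 1/t, so it remains to see that t^(2q-1) (|x_k| - t) <= |x_k|^(2q) where |x_k| >
   t. This is where the exponent 2q comes from. *)
have H2 : `|pairing y z| <= (2 ^+ l)^-1 * B.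
  rewrite -(@ler_pXn2r _ q) ?nnegrE ?mulr_ge0 ?invr_ge0 ?(ltW p0)//.
  have : `|pairing (fun k => (2 ^+ l)^-1 * y k) z| ^+ q <=
      \sum_(k < N) mu k * `|(2 ^+ l)^-1 * y k|.
    apply: muP => k.
    rewrite normrM gtr0_norm ?invr_gt0// ler_pdivrMl// mulr1 yE.
    rewrite minEle; case: ifP => _; first by rewrite subrr ltW.
    by rewrite lerBlDr; have := xl k; rewrite exprS mulr_natl mulr2n.
  rewrite pairingZ !normrM gtr0_norm ?invr_gt0// !exprMn.
  rewrite {1}exprVn ler_pdivrMl ?exprn_gt0// => /le_trans; apply.
  rewrite exprVn ler_pdivlMl ?exprn_gt0//; apply: le_trans xB.
  rewrite !mulr_sumr; apply: ler_sum => k _.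
  rewrite normrM gtr0_norm ?invr_gt0// yE.
  rewrite !mulrA -[_ * _ * mu k]mulrC -!mulrA ler_wpM2l//.
  rewrite minEle; case: ifPn => [_|]; first by rewrite subrr !mulr0 exprn_ge0.
  rewrite -ltNge => /ltW xl'.
  rewrite -[q]prednK// doubleS.
  set t := 2 ^+ l in p0 xl' *; set u := `|x k| in xl' *; set r := q.-1.
  have -> : t ^+ r.+1 * (t ^+ r.+1 * (t^-1 * (u - t))) =
      t ^+ r.*2.+1 * (u - t).
    rewrite -addnn !exprS exprD; field; exact: lt0r_neq0.
  rewrite [leRHS]exprSr ler_pM ?exprn_ge0 ?subr_ge0 ?(ltW p0)//.
    by rewrite lerXn2r ?nnegrE ?(ltW p0)// (le_trans (ltW p0)).
  by rewrite gerBl ltW.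
apply: le_trans (ler_normD _ _) _; apply: le_trans (lerD H1 H2) _.
rewrite exprS invfM; lra.
Qed.

Lemma power_summing_sqr_le q D : odd q -> 0 <= D -> power_summing q.+1 D ->
  let A := q.+1%:R * (2 * D) + 1 in
  exists mu : 'I_N -> R, [/\ forall k, 0 <= mu k, \sum_(k < N) mu k <= A &
    forall x z, pairing x z ^+ 2 <=
      2 * A ^+ 2 + 8 * (1 + \sum_(k < N) mu k * x k ^+ q.+1.*2)].
Proof.
move=> oq D0 sD A; have eq : ~~ odd q.+1 by rewrite /= oq.
have A1 : 1 <= A by rewrite lerDr !mulr_ge0.
have [mu [mu0 smu muD]] := power_summing_domination oq sD.
exists mu; split => // x z.
have -> : \sum_(k < N) mu k * x k ^+ q.+1.*2 =
    \sum_(k < N) mu k * `|x k| ^+ q.+1.*2.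
  apply: eq_bigr => k _; rewrite -normrX ger0_norm// exprn_even_ge0//.
  by rewrite odd_double.
set M := \sum_(k < N) _; have M0 : 0 <= M.
  by apply: sumr_ge0 => k _; rewrite mulr_ge0// exprn_ge0.
(* The summand 1 makes B >= 1, so that M <= B^2 <= B^(q+1); likewise A >= 1 gives A <= A^(q+1). *)
pose B := Num.sqrt (1 + M).
have B2 : B ^+ 2 = 1 + M by rewrite sqr_sqrtr// addr_ge0.
have B1 : 1 <= B by rewrite -sqrtr1 ler_wsqrtr// lerDl.
(* The number [l] of layers depends on [x], but it disappears from the bound because 2 - 2 / 2^l <=
   2. *)
pose r := \sum_(k < N) `|x k|; pose l := Num.bound r.
have xl k : `|x k| <= 2 ^+ l.
  rewrite (@le_trans _ _ r)//; first by rewrite /r (bigD1 k)//= lerDl sumr_ge0.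
  rewrite (le_trans (ltW (archi_boundP _))) ?sumr_ge0// -natrX ler_nat.
  by rewrite ltnW// ltn_expl.
have H : `|pairing x z| <= A + (2 - 2 / 2 ^+ l) * B.
  apply: (@dominated_dyadic q.+1 mu) => //.
  - move=> y w y1; rewrite -normrX ger0_norm ?exprn_even_ge0//; exact: muD.
  - exact: le_trans A1.
  - exact: le_trans B1.
  - by rewrite (le_trans smu)// ler_eXnr.
  - rewrite (@le_trans _ _ (B ^+ 2))// ?B2 ?lerDr//.
    by rewrite -B2 ler_weXn2l// ltnS odd_gt0.
have {}H : `|pairing x z| <= A + 2 * B.
  apply: (le_trans H); rewrite lerD2l ler_wpM2r ?(le_trans _ B1)//.
  by rewrite gerBl divr_ge0 ?exprn_ge0.
have : `|pairing x z| ^+ 2 <= (A + 2 * B) ^+ 2.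
  by rewrite lerXn2r ?nnegrE// (le_trans _ H).
rewrite -normrX ger0_norm ?sqr_ge0// => /le_trans; apply.
rewrite -B2; have := sqr_ge0 (A - 2 * B); nra.
Qed.

End domination.

(** * Independence and Gaussian moments *)

Section weighted_integral.
Local Open Scope ereal_scope.
Context {R : realType} {d : measure_display} {Y : measurableType d}.

Import HBNNSimple.

Lemma ge0_integral_weight_nnsfun d1 (T : measurableType d1)
    (m : {measure set T -> \bar R}) (W : T -> R) (h : T -> Y)
    (s : {nnsfun Y >-> R}) :
  measurable_fun setT W -> (forall t, 0 <= W t)%R -> measurable_fun setT h ->
  \int[m]_t (W t * s (h t))%:E =
  \sum_(y \in range s) y%:E * \int[m]_t (W t * \1_(s @^-1` [set y]) (h t))%:E.
Proof.
move=> mW W0 mh.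
have m1 (y : R) : measurable_fun setT (fun t => W t * \1_(s @^-1` [set y]) (h t))%R.
  by apply: measurable_funM => //; apply: measurableT_comp mh; exact: measurable_indic.
have ge0 (y : R) t : 0 <= (W t * \1_(s @^-1` [set y]) (h t))%:E.
  by rewrite lee_fin mulr_ge0// indicE.
transitivity (\int[m]_t \sum_(y \in range s)
    (y%:E * (W t * \1_(s @^-1` [set y]) (h t))%:E)).
  apply: eq_integral => t _; rewrite fimfunE mulr_fsumr -fsumEFin//.
  by apply: eq_fsbigr => y _; rewrite -EFinM mulrCA.
rewrite ge0_integral_fsum//.
- apply: eq_fsbigr => y /[!inE] -[x _ <-].
  rewrite ge0_integralZl//; first exact/measurable_EFinP.
  by rewrite lee_fin.
- by move=> y; apply/measurable_EFinP; exact: measurable_funM.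
- move=> y t _; have [y0|y0] := leP 0%R y; first by rewrite mule_ge0.
  rewrite (_ : _ @^-1` _ = set0) ?indic0 ?mulr0 ?mule0//.
  by apply/seteqP; split => // x /= yE; move: y0; rewrite -yE ltNge fun_ge0.
Qed.

Lemma ge0_integral_weight_approx d1 (T : measurableType d1)
    (m : {measure set T -> \bar R}) (W : T -> R) (h : T -> Y) (f : Y -> R)
    (mf : measurable_fun setT (EFin \o f)) :
  measurable_fun setT W -> (forall t, 0 <= W t)%R -> measurable_fun setT h ->
  (forall y, 0 <= f y)%R ->
  \int[m]_t (W t * f (h t))%:E =
  limn (fun n => \int[m]_t (W t * nnsfun_approx measurableT mf n (h t))%:E).
Proof.
move=> mW W0 mh f0; rewrite -monotone_convergence//.
- apply: eq_integral => t _; apply/esym/cvg_lim => //.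
  rewrite EFinM.
  under eq_fun do rewrite EFinM.
  apply: cvgeZl => //; apply: (cvg_nnsfun_approx measurableT mf) => // y _.
  by rewrite lee_fin.
- move=> n; apply/measurable_EFinP; apply: measurable_funM => //.
  exact: measurableT_comp.
- by move=> n t _; rewrite lee_fin mulr_ge0.
- move=> t _ i j ij; rewrite lee_fin ler_wpM2l//.
  exact/lefP/nd_nnsfun_approx.
Qed.

(* Covers at once change of variables, densities and independence. *)
Lemma ge0_integral_weight_eq d1 d2 (T1 : measurableType d1) (T2 : measurableType d2)
    (m1 : {measure set T1 -> \bar R}) (m2 : {measure set T2 -> \bar R})
    (W1 : T1 -> R) (W2 : T2 -> R) (h1 : T1 -> Y) (h2 : T2 -> Y) (f : Y -> R) :
  measurable_fun setT W1 -> (forall t, 0 <= W1 t)%R -> measurable_fun setT h1 ->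
  measurable_fun setT W2 -> (forall t, 0 <= W2 t)%R -> measurable_fun setT h2 ->
  (forall B, measurable B -> \int[m1]_t (W1 t * \1_B (h1 t))%:E =
                             \int[m2]_t (W2 t * \1_B (h2 t))%:E) ->
  measurable_fun setT f -> (forall y, 0 <= f y)%R ->
  \int[m1]_t (W1 t * f (h1 t))%:E = \int[m2]_t (W2 t * f (h2 t))%:E.
Proof.
move=> mW1 W10 mh1 mW2 W20 mh2 H /measurable_EFinP mf f0.
rewrite (ge0_integral_weight_approx m1 mf)// (ge0_integral_weight_approx m2 mf)//.
congr (limn _); apply/funext => n; rewrite !ge0_integral_weight_nnsfun//.
by apply: eq_fsbigr => y _; rewrite H.
Qed.

End weighted_integral.

Section independence.
Local Open Scope ereal_scope.
Context {R : realType} {d : measure_display} {Omega : measurableType d}.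
Context {P : probability Omega R} (g : nat -> {RV P >-> R}).

Lemma measurable_prod_RV (n : nat) (p : pred 'I_n) (h : nat -> R -> R) :
  (forall j, measurable_fun setT (h j)) ->
  measurable_fun setT (fun t => \prod_(j < n | p j) h j (g j t))%R.
Proof.
move=> mh; under eq_fun do rewrite -big_filter.
apply: measurable_prod => j _; exact: measurableT_comp.
Qed.

Lemma independent_integral_prod_indic (n : nat) (B : nat -> set R) (e : nat -> R) :
  independent g -> (forall j, measurable (B j)) ->
  (forall j, (j < n)%N -> \int[P]_t (\1_(B j) (g j t))%:E = (e j)%:E) ->
  \int[P]_t (\prod_(j < n) \1_(B j) (g j t))%:E = (\prod_(j < n) e j)%:E.
Proof.
move=> ig mB eP.
have mgB j : measurable (g j @^-1` B j).
  by rewrite -[X in measurable X]setTI; exact: measurable_funP.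
have {}eP (j : 'I_n) : P (g j @^-1` B j) = (e j)%:E.
  rewrite -eP// (_ : \int[P]_t _ = \int[P]_t (\1_(g j @^-1` B j) t)%:E)//.
  by rewrite integral_indic ?setIT.
have E t : (\prod_(j < n) \1_(B j) (g j t))%R =
    \1_(\bigcap_(j in [set` iota 0 n]) (g j @^-1` B j)) t :> R.
  rewrite !indicE; case: (boolP (t \in _)) => [/[!inE] tB|].
    rewrite big1// => j _; rewrite indicE mem_set//; apply: tB => /=.
    by rewrite mem_iota/=.
  rewrite notin_setE/= => /existsNP[j] /not_implyP[].
  rewrite /= mem_iota/= add0n => jn Bj.
  rewrite (bigD1 (Ordinal jn))//= indicE memNset ?mul0r//.
under eq_integral do rewrite E.
rewrite integral_indic ?setIT//; last first.
  by apply: bigcap_measurableType => //; exact: countable_finite_seq.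
transitivity (\prod_(j <- iota 0 n) P (g j @^-1` B j)).
  by rewrite -(ig _ _ (iota_uniq _ _) mB).
rewrite -[n in iota 0 n]subn0 -/(index_iota 0 n) big_mkord.
by rewrite -prodEFin; apply: eq_bigr => j _.
Qed.

(* The indicators are replaced by general functions one coordinate at a time. *)
Lemma independent_integral_prod_hybrid (n m : nat) (h : nat -> R -> R)
    (e : nat -> R) : independent g ->
  (forall j, measurable_fun setT (h j)) -> (forall j y, 0 <= h j y)%R ->
  (forall j, (m <= j < n)%N -> exists2 B, measurable B & h j = \1_B) ->
  (forall j, \int[P]_t (h j (g j t))%:E = (e j)%:E) ->
  \int[P]_t (\prod_(j < n) h j (g j t))%:E = (\prod_(j < n) e j)%:E.
Proof.
move=> ig; elim: m h e => [|m IH] h e mh h0 hB he.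
  have /choice[B BP] j : exists B, measurable B /\ ((j < n)%N -> h j = \1_B).
    have [jn|] := ltnP j n; last by exists setT.
    by have [B mB ->] := hB j jn; exists B.
  rewrite -(independent_integral_prod_indic ig (fun j => (BP j).1)).
    by apply: eq_integral => t _; congr _%:E; apply: eq_bigr => j _; rewrite (BP _).2.
  by move=> j jn; rewrite -he (BP j).2.
have e0 j : (0 <= e j)%R.
  by rewrite -lee_fin -he integral_ge0// => t _; rewrite lee_fin.
have [mn|nm] := ltnP m n; last first.
  apply: IH => // j /andP[mj jn]; move: (leq_trans jn nm).
  by rewrite ltnNge mj.
pose i := Ordinal mn.
pose W t := (\prod_(j < n | j != i) h j (g j t))%R.
pose c := (\prod_(j < n | j != i) e j)%R.
rewrite (bigD1 i)//= -/c mulrC EFinM -he.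
rewrite -ge0_integralZl//; last 3 first.
- by apply/measurable_EFinP; exact: measurableT_comp.
- by move=> t _; rewrite lee_fin.
- by rewrite lee_fin prodr_ge0.
transitivity (\int[P]_t (W t * h m (g m t))%:E).
  by apply: eq_integral => t _; rewrite (bigD1 i)//= mulrC.
under [in RHS]eq_integral do rewrite -EFinM.
(* The weights are the product of the other factors on the left and the product [c] of their means
   on the right. It then suffices to treat an indicator in place of [h m], and [h'] has indicators
   from coordinate m on, so the induction hypothesis applies to it. *)
apply: (@ge0_integral_weight_eq R _ _ _ _ _ _ P P W (cst c)) => //.
- exact: measurable_prod_RV.
- by move=> t; apply: prodr_ge0.
- by move=> t; apply: prodr_ge0.
move=> B mB.
pose h' j := if j == m then \1_B else h j.
pose e' j := if j == m then fine (\int[P]_t (\1_B (g m t))%:E) else e j.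
have mgB : measurable (g m @^-1` B).
  by rewrite -[X in measurable X]setTI; exact: measurable_funP.
have fB : \int[P]_t (\1_B (g m t))%:E \is a fin_num.
  rewrite (_ : \int[P]_t _ = \int[P]_t (\1_(g m @^-1` B) t)%:E)//.
  by rewrite integral_indic ?setIT// fin_num_measure.
have -> : \int[P]_t (cst c t * \1_B (g m t))%:E = (\prod_(j < n) e' j)%:E.
  rewrite (bigD1 i)//= mulrC EFinM /e' eqxx fineK//.
  under eq_integral do rewrite EFinM.
  rewrite ge0_integralZl//.
  - by congr (_%:E * _); apply: eq_bigr => j /negPf; rewrite -val_eqE/= => ->.
  - exact/measurable_EFinP/(@measurable_indic _ _ _ setT _ mgB).
  - by rewrite lee_fin prodr_ge0.
rewrite -(IH h' e').
- apply: eq_integral => t _; rewrite (bigD1 i)//= /h' eqxx mulrC.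
  congr (_ * _)%:E; apply: eq_bigr => j /negPf; rewrite -val_eqE/= => ->//.
- by move=> j; rewrite /h'; case: ifP => // _; exact: measurable_indic.
- by move=> j y; rewrite /h'; case: ifP => // _; rewrite indicE.
- move=> j /andP[mj jn]; rewrite /h'; case: (eqVneq j m) => [_|jm]; first by exists B.
  by apply: hB; rewrite ltn_neqAle eq_sym jm mj.
- move=> j; rewrite /h' /e'; case: (eqVneq j m) => [->|//].
  by rewrite fineK.
Qed.

Lemma independent_integral_prod (n : nat) (h : nat -> R -> R) (e : nat -> R) :
  independent g ->
  (forall j, measurable_fun setT (h j)) -> (forall j y, 0 <= h j y)%R ->
  (forall j, \int[P]_t (h j (g j t))%:E = (e j)%:E) ->
  \int[P]_t (\prod_(j < n) h j (g j t))%:E = (\prod_(j < n) e j)%:E.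
Proof.
move=> ig mh h0 he; apply: (@independent_integral_prod_hybrid n n) => //.
by move=> j /andP[nj]; rewrite ltnNge nj.
Qed.

End independence.

Section gaussian_moments.
Local Open Scope ereal_scope.
Context {R : realType} {d : measure_display} {Omega : measurableType d}.
Context {P : probability Omega R}.

(** Completing the square turns the density times e^(ax) into e^(a^2/2) times the Gaussian density
    centred at [a], whose integral is 1. *)
Lemma standard_gaussian_expR (X : {RV P >-> R}) (a : R) : standard_gaussian X ->
  \int[P]_t (expR (a * X t))%:E = (expR (a ^+ 2 / 2))%:E.
Proof.
move=> gX.
have pdfE (x : R) : (normal_pdf 0 1 x * expR (a * x) =
    expR (a ^+ 2 / 2) * normal_pdf a 1 x)%R.
  rewrite !normal_pdfE// /normal_fun -mulrA [RHS]mulrCA; congr (_ * _)%R.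
  rewrite -!expRD; congr (expR _).
  by field.
transitivity (\int[P]_t (cst 1%R t * expR (a * X t))%:E).
  by apply: eq_integral => t _; rewrite mul1r.
rewrite (@ge0_integral_weight_eq R _ _ _ _ _ _ P lebesgue_measure (cst 1%R)
  (normal_pdf 0 1) X (fun x => x) (fun x => expR (a * x)))//.
- under eq_integral do rewrite pdfE EFinM.
  rewrite ge0_integralZl//.
  + by rewrite integral_normal_pdf ?mule1// oner_neq0.
  + by apply/measurable_EFinP; exact: measurable_normal_pdf.
  + by move=> x _; rewrite lee_fin normal_pdf_ge0.
- exact: measurable_normal_pdf.
- by move=> x; exact: normal_pdf_ge0.
- move=> B mB.
  have mXB : measurable (X @^-1` B).
    by rewrite -[Y in measurable Y]setTI; exact: measurable_funP.
  transitivity (P (X @^-1` B)).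
    rewrite -[in RHS](setIT (X @^-1` B)) -integral_indic//.
    by apply: eq_integral => t _; rewrite mul1r.
  have := gX B mB; rewrite /distribution /pushforward => ->.
  rewrite /normal_prob [LHS]integral_mkcond; apply: eq_integral => x _.
  rewrite patchE indicE; by case: ifP => _; rewrite ?mulr1 ?mulr0.
- apply: measurableT_comp => //; exact: mulrl_measurable.
Qed.

Context (g : nat -> {RV P >-> R}).

Lemma gaussian_sequence_expR (n : nat) (a : nat -> R) : gaussian_sequence g ->
  \int[P]_t (expR (\sum_(j < n) a j * g j t))%:E =
  (expR ((\sum_(j < n) a j ^+ 2) / 2))%:E.
Proof.
move=> [ig gg]; rewrite mulr_suml expR_sum.
under eq_integral do rewrite expR_sum.
rewrite (@independent_integral_prod _ _ _ _ _ n (fun j x => expR (a j * x))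
  (fun j => expR (a j ^+ 2 / 2)) ig)//.
- by move=> j; apply: measurableT_comp => //; exact: mulrl_measurable.
- by move=> j; apply: standard_gaussian_expR; exact: gg.
Qed.

(** For even p, x^p <= p! (e^x + e^-x), and both exponentials of a Gaussian sum with sum_j a_j^2 <=
    1 have mean at most e^(1/2). The law of the sum itself is never identified. *)
Definition gaussian_moment_bound (p : nat) : R := (p`!%:R * (2 * expR 2^-1))%R.

Lemma measurable_gaussian_sum (n : nat) (a : nat -> R) :
  measurable_fun setT (fun t => \sum_(j < n) a j * g j t)%R.
Proof. by apply: measurable_sum => j; apply: measurable_funM. Qed.

Lemma gaussian_sum_moment_le (p n : nat) (a : nat -> R) : gaussian_sequence g ->
  ~~ odd p -> (\sum_(j < n) a j ^+ 2 <= 1)%R ->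
  \int[P]_t ((\sum_(j < n) a j * g j t) ^+ p)%:E <= (gaussian_moment_bound p)%:E.
Proof.
move=> gg ep a1; pose S t := (\sum_(j < n) a j * g j t)%R.
have mS : measurable_fun setT S by exact: measurable_gaussian_sum.
have expS (b : nat -> R) : (\sum_(j < n) b j ^+ 2 <= 1)%R ->
    \int[P]_t (expR (\sum_(j < n) b j * g j t))%:E <= (expR 2^-1)%:E.
  by move=> b1; rewrite gaussian_sequence_expR// lee_fin ler_expR ler_pdivrMr// mulVf.
have H x : (x ^+ p <= p`!%:R * (expR x + expR (- x)) :> R)%R.
  have -> : (x ^+ p = `|x| ^+ p)%R by rewrite -normrX ger0_norm// exprn_even_ge0.
  have p0 : (0 < p`!%:R :> R)%R by rewrite ltr0n fact_gt0.
  rewrite mulrC -ler_pdivrMr//; apply: (@le_trans _ _ (expR `|x|)).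
    case: (p) => [|r]; first by rewrite expr0 fact0 divr1 -expR0 ler_expR.
    by have := expR_ge1Dxn r (normr_ge0 x); apply: le_trans; rewrite lerDr.
  by case: (ger0P x) => _; rewrite (lerDl, lerDr) expR_ge0.
apply: (@le_trans _ _ (\int[P]_t (p`!%:R%:E * ((expR (S t))%:E + (expR (- S t))%:E)))).
  apply: ge0_le_integral => //.
  - by move=> t _; rewrite lee_fin exprn_even_ge0.
  - by apply/measurable_EFinP; exact: measurable_funX.
  - apply/measurable_EFinP; apply: measurable_funM => //; apply: measurable_funD.
      exact: measurableT_comp.
    by apply: measurableT_comp => //; exact: measurable_funN.
  - by move=> t _; rewrite -EFinD -EFinM lee_fin H.
have m1 : measurable_fun setT (fun t => (expR (S t))%:E).
  by apply/measurable_EFinP; exact: measurableT_comp.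
have m2 : measurable_fun setT (fun t => (expR (- S t))%:E).
  by apply/measurable_EFinP; apply: measurableT_comp => //; exact: measurable_funN.
rewrite ge0_integralZl//; last 2 first.
- exact: emeasurable_funD.
- by move=> t _; rewrite adde_ge0// lee_fin expR_ge0.
rewrite EFinM lee_pmul2l ?fin_numE// ?lte_fin ?ltr0n ?fact_gt0//.
rewrite ge0_integralD//; try by move=> t _; rewrite lee_fin expR_ge0.
rewrite mulr_natl mulr2n EFinD leeD//; first exact: expS.
have -> : \int[P]_t (expR (- S t))%:E =
    \int[P]_t (expR (\sum_(j < n) - a j * g j t))%:E.
  apply: eq_integral => t _; congr (expR _)%:E; rewrite -sumrN.
  by apply: eq_bigr => j _; rewrite mulNr.
by apply: (expS (fun j => - a j)%R); under eq_bigr do rewrite sqrrN.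
Qed.

End gaussian_moments.

(** * Strong measurability and Bochner integrals *)

Section strong_measurability.
Context {R : realType} {d : measure_display} {Omega : measurableType d}.
Implicit Types X Y Z : normedModType R.

Import HBSimple.

Lemma measurable_simple_preimage X (s : Omega -> X) (A : set X) :
  simple_fun s -> measurable (s @^-1` A).
Proof.
move=> [fs ms].
rewrite (_ : _ @^-1` _ = \bigcup_(x in range s `&` A) s @^-1` [set x]).
  by apply: fin_bigcup_measurable => //; exact: finite_setIl.
apply/seteqP; split => [t At|t [x [_ Ax] /= ->]//].
by exists (s t) => //; split => //; exists t.
Qed.

Lemma simple_fun_comp2 X Y Z (F : X -> Y -> Z) (s1 : Omega -> X) (s2 : Omega -> Y) :
  simple_fun s1 -> simple_fun s2 -> simple_fun (fun t => F (s1 t) (s2 t)).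
Proof.
move=> [fs1 ms1] ss2; split; first exact: (finite_image11 F fs1 ss2.1).
move=> z; rewrite (_ : _ @^-1` _ = \bigcup_(x in range s1)
    (s1 @^-1` [set x] `&` s2 @^-1` [set y | F x y = z])).
  apply: fin_bigcup_measurable => // x _.
  by apply: measurableI => //; exact: measurable_simple_preimage.
apply/seteqP; split => [t /= Fz|t [x _ /= [-> ]]//].
by exists (s1 t) => //; exists t.
Qed.

Lemma strongly_measurable_comp2 X Y Z (F : X -> Y -> Z)
    (f1 : Omega -> X) (f2 : Omega -> Y) :
  (forall (u : nat -> X) (v : nat -> Y) x y, u n @[n --> \oo] --> x ->
     v n @[n --> \oo] --> y -> F (u n) (v n) @[n --> \oo] --> F x y) ->
  strongly_measurable f1 -> strongly_measurable f2 ->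
  strongly_measurable (fun t => F (f1 t) (f2 t)).
Proof.
move=> FC [s1 [ss1 cs1]] [s2 [ss2 cs2]].
exists (fun n t => F (s1 n t) (s2 n t)); split=> [n|t]; last exact: FC.
exact: simple_fun_comp2.
Qed.

Lemma strongly_measurable_cst X (x : X) : strongly_measurable (fun _ : Omega => x).
Proof.
exists (fun _ _ => x); split => [n|t]; last exact: cvg_cst.
split; first exact: (finite_image_cst x).
by move=> y; have [->|xy] := pselect (x = y);
  [rewrite (_ : _ @^-1` _ = setT)|rewrite (_ : _ @^-1` _ = set0)] => //;
  apply/seteqP; split.
Qed.

Lemma strongly_measurableD X (f1 f2 : Omega -> X) : strongly_measurable f1 ->
  strongly_measurable f2 -> strongly_measurable (fun t => f1 t + f2 t).
Proof. by apply: strongly_measurable_comp2 => u v x y; exact: cvgD. Qed.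

Lemma strongly_measurableB X (f1 f2 : Omega -> X) : strongly_measurable f1 ->
  strongly_measurable f2 -> strongly_measurable (fun t => f1 t - f2 t).
Proof.
by apply: (strongly_measurable_comp2 (F := fun x y => x - y)) => u v x y; exact: cvgB.
Qed.

Lemma strongly_measurable_sum X (n : nat) (f : nat -> Omega -> X) :
  (forall j, strongly_measurable (f j)) ->
  strongly_measurable (fun t => \sum_(j < n) f j t).
Proof.
move=> mf; elim: n => [|n IH].
  by under eq_fun do rewrite big_ord0; exact: strongly_measurable_cst.
by under eq_fun do rewrite big_ord_recr; exact: strongly_measurableD.
Qed.

Lemma simple_fun_strongly_measurable X (s : Omega -> X) :
  simple_fun s -> strongly_measurable s.
Proof. by exists (fun=> s); split => // t; exact: cvg_cst. Qed.

Lemma measurable_strongly_measurable (f : Omega -> R) :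
  measurable_fun setT f -> strongly_measurable (f : Omega -> R^o).
Proof.
move=> /measurable_EFinP mf; have [s sf] := approximation_sfun measurableT mf.
exists (fun n => s n : Omega -> R^o); split => [n|t].
  split; first exact: fimfunP.
  by move=> x; rewrite -[X in measurable X]setTI; exact: measurable_funP.
by have /fine_cvgP[] := sf t I.
Qed.

Lemma strongly_measurableZ X (f : Omega -> R) (h : Omega -> X) :
  measurable_fun setT f -> strongly_measurable h ->
  strongly_measurable (fun t => f t *: h t).
Proof.
move=> /measurable_strongly_measurable.
by apply: (strongly_measurable_comp2 (F := fun (a : R^o) y => a *: y)) => u v x y; exact: cvgZ.
Qed.

Lemma measurable_comp_strongly_measurable X (f : Omega -> X) (h : X -> R) :
  continuous h -> strongly_measurable f -> measurable_fun setT (fun t => h (f t)).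
Proof.
move=> hC [s [ss cs]]; apply: (measurable_fun_cvg (h := fun n t => h (s n t))) => //.
  by move=> n _ B _; rewrite setTI; apply: (measurable_simple_preimage (h @^-1` B)).
by move=> t _; apply: continuous_cvg => //; exact: hC.
Qed.

Lemma measurable_norm_strongly_measurable X (f : Omega -> X) :
  strongly_measurable f -> measurable_fun setT (fun t => `|f t|).
Proof. by apply: measurable_comp_strongly_measurable; exact: norm_continuous. Qed.

End strong_measurability.

Lemma bop_norm_ge0 (R : realType) (V W : normedModType R) (f : bop V W) :
  0 <= bop_norm f.
Proof. exact: (normr_ge0 f). Qed.

Lemma bop_continuous (R : realType) (V W : normedModType R) (f : bop V W) :
  continuous f.
Proof.
(* The summand 1 keeps the divisor positive when [f] is zero. *)
have f1 : 0 < bop_norm f + 1 by rewrite ltr_wpDl// bop_norm_ge0.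
move=> x; apply/cvgrPdist_lt => e e0; near=> y.
rewrite -linearB (le_lt_trans (bop_normP _ _))//.
apply: (@le_lt_trans _ _ ((bop_norm f + 1) * `|x - y|)).
  by rewrite ler_wpM2r// lerDl.
rewrite mulrC -ltr_pdivlMr//; near: y.
by apply: cvgr_dist_lt; [exact: cvg_id|exact: divr_gt0].
Unshelve. all: by end_near. Qed.

Section bochner_functional.
Context {R : realType} {d : measure_display} {Omega : measurableType d}.
Context {P : probability Omega R} {X : normedModType R}.

Lemma simple_fun_sumE (s : Omega -> X) (h : X -> R) t : simple_fun s ->
  h (s t) = \sum_(x <- fset_set (range s)) h x * \1_(s @^-1` [set x]) t.
Proof.
move=> [fs _]; have st : s t \in fset_set (range s).
  by rewrite in_fset_set//; apply: mem_set; exists t.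
rewrite (bigD1_seq (s t)) ?fset_uniq//= indicE mem_set// mulr1 big1 ?addr0//.
by move=> x xs; rewrite indicE memNset ?mulr0//= => sx; rewrite sx eqxx in xs.
Qed.

Lemma simple_fun_integrable (s : Omega -> X) (phi : dual X) : simple_fun s ->
  P.-integrable setT (fun t => (phi (s t))%:E).
Proof.
move=> ss; under eq_fun do rewrite (simple_fun_sumE phi _ ss) -sumEFin.
apply: integrable_sum => // x _; under eq_fun do rewrite EFinM.
by apply: integrableZl => //; apply: integrable_indic => //; exact: ss.2.
Qed.

Lemma integral_simple_fun (s : Omega -> X) (phi : dual X) : simple_fun s ->
  (\int[P]_t (phi (s t))%:E = (phi (simple_integral P s))%:E)%E.
Proof.
move=> ss; under eq_integral do rewrite (simple_fun_sumE phi _ ss) -sumEFin.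
have mi x : P.-integrable setT (fun t => (\1_(s @^-1` [set x]) t)%:E).
  by apply: integrable_indic => //; exact: ss.2.
rewrite integral_sum//; last first.
  by move=> x; under eq_fun do rewrite EFinM; exact: integrableZl.
rewrite /simple_integral fsbig_finite/=; last exact: ss.1.
rewrite linear_sum -sumEFin; apply: eq_bigr => x _.
under eq_integral do rewrite EFinM.
rewrite integralZl// integral_indic//; last exact: ss.2.
rewrite setIT linearZ/= EFinM muleC fineK// fin_num_measure//; exact: ss.2.
Qed.

(** The values of [phi] at the integrals of the approximating simple functions converge to [phi v]
    by continuity, and to the integral of phi(f) by L_1 convergence. *)
Lemma has_bochner_integral_functional (f : Omega -> X) (v : X) (phi : dual X) :
  has_bochner_integral P f v ->
  P.-integrable setT (fun t => (phi (f t))%:E) ->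
  (\int[P]_t (phi (f t))%:E = (phi v)%:E)%E.
Proof.
move=> [mf [s [ss s0 sv]]] fi; set I := (\int[P]_t _)%E.
have If : I \is a fin_num by exact: integrable_fin_num.
have c1 : phi (simple_integral P (s n)) @[n --> \oo] --> (phi v : R).
  by apply: continuous_cvg => //; exact: bop_continuous.
suff c2 : phi (simple_integral P (s n)) @[n --> \oo] --> fine I.
  by rewrite -[LHS]fineK// (cvg_unique _ c2 c1).
have c3 : ((bop_norm phi)%:E * \int[P]_t (`|f t - s n t|)%:E)%E @[n --> \oo] --> 0%E.
  by rewrite -[X in _ --> X](mule0 (bop_norm phi)%:E); apply: cvgeZl.
have mfs n : strongly_measurable (fun t => f t - s n t).
  by apply: strongly_measurableB => //; exact: simple_fun_strongly_measurable.
have c4 : (`|fine I - phi (simple_integral P (s n))|%:E)%E @[n --> \oo] --> 0%E.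
  apply: (squeeze_cvge _ (cvg_cst 0%E) c3); near=> n.
  rewrite lee_fin normr_ge0/= -abse_EFin EFinB fineK// -integral_simple_fun//.
  have si := simple_fun_integrable phi (ss n).
  have -> : (I - \int[P]_t (phi (s n t))%:E = \int[P]_t (phi (f t - s n t))%:E)%E.
    by rewrite -integralB//; apply: eq_integral => t _; rewrite linearB.
  have mphi : measurable_fun setT (fun t => phi (f t - s n t)).
    by apply: measurable_comp_strongly_measurable (mfs n); exact: bop_continuous.
  apply: le_trans (le_abse_integral _ _ _) _ => //; first exact/measurable_EFinP.
  rewrite -ge0_integralZl//; last 2 first.
  - exact/measurable_EFinP/measurable_norm_strongly_measurable.
  - by rewrite lee_fin bop_norm_ge0.
  apply: ge0_le_integral => //.
  - by apply: measurableT_comp => //; exact/measurable_EFinP.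
  - apply/measurable_EFinP/measurable_funM => //.
    exact: measurable_norm_strongly_measurable.
  - by move=> t _; rewrite abse_EFin -EFinM lee_fin bop_normP.
apply/cvgrPdist_lt => e e0.
have /fine_cvgP[_ /cvgrPdist_lt/(_ e e0)] := c4.
by apply: filterS => n /=; rewrite sub0r normrN normr_id.
Unshelve. all: by end_near. Qed.

End bochner_functional.

(** * Cotype *)

Section cotype_power_summing.
Context {R : realType}.

Lemma rademacher_L2_le1 (V : normedModType R) (m : nat) (y : 'I_m -> V) :
  (forall eps : {ffun 'I_m -> bool}, `|\sum_(i < m) (-1) ^+ eps i *: y i| <= 1) ->
  rademacher_L2 y <= 1.
Proof.
move=> y1; rewrite /rademacher_L2 -[leRHS]sqrtr1 ler_wsqrtr//.
rewrite ler_pdivrMl ?exprn_gt0// mulr1.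
rewrite (@le_trans _ _ (\sum_(eps : {ffun 'I_m -> bool}) 1))//.
  by apply: ler_sum => eps _; rewrite exprn_ile1 ?y1.
by rewrite sumr_const card_ffun card_bool card_ord natrX.
Qed.

(** Passage from a real cotype exponent [q0] to an integer q >= q0: with M = max(1, C), each |y_i|
    is at most M, so |y_i|^q <= |y_i|^q0 M^(q - q0), and the sum of the |y_i|^q0 is at most M^q0.
    The maximum keeps M positive for every [C]. *)
Lemma cotype_sum_norm_le (V : normedModType R) (q0 C : R) (q m : nat)
    (y : 'I_m -> V) : 0 < q0 -> q0 <= q%:R ->
  (\sum_(i < m) `|y i| `^ q0) `^ q0^-1 <= C * rademacher_L2 y ->
  (forall eps : {ffun 'I_m -> bool}, `|\sum_(i < m) (-1) ^+ eps i *: y i| <= 1) ->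
  \sum_(i < m) `|y i| ^+ q <= Num.max 1 C ^+ q.
Proof.
move=> q00 q0q yC /rademacher_L2_le1 y1; set M := Num.max 1 C.
have M1 : 1 <= M by rewrite le_max lexx.
have M0 : 0 <= M by exact: le_trans M1.
set S := \sum_(i < m) _ in yC.
have S0 : 0 <= S by apply: sumr_ge0 => i _; exact: powR_ge0.
have {}yC : S `^ q0^-1 <= M.
  apply: (le_trans yC); have r0 : 0 <= rademacher_L2 y by exact: sqrtr_ge0.
  rewrite (@le_trans _ _ (M * rademacher_L2 y))//; last by rewrite ler_piMr.
  by rewrite ler_wpM2r// le_max lexx orbT.
have SM : S <= M `^ q0.
  rewrite -[S](@powRr1)// -(@mulVf _ q0) ?gt_eqF// powRrM.
  by rewrite ge0_ler_powR// ?nnegrE ?powR_ge0// ltW.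
have yM i : `|y i| <= M.
  rewrite (le_trans _ yC)// -[leLHS](@powRr1)// -(@mulfV _ q0) ?gt_eqF// powRrM.
  rewrite ge0_ler_powR ?nnegrE ?powR_ge0 ?invr_ge0 ?(ltW q00)//.
  by rewrite /S (bigD1 i)//= lerDl sumr_ge0// => j _; exact: powR_ge0.
have H i : `|y i| ^+ q <= `|y i| `^ q0 * M `^ (q%:R - q0).
  have [->|yi0] := eqVneq (y i) 0.
    rewrite normr0 expr0n gtn_eqF ?mulr_ge0 ?powR_ge0//.
    by rewrite -(ltr0n R) (lt_le_trans q00).
  rewrite -powR_mulrn// -{1}(subrK q0 q%:R) addrC powRD; last first.
    by rewrite normr_eq0 yi0 implybT.
  rewrite ler_wpM2l ?powR_ge0// ge0_ler_powR// ?nnegrE ?subr_ge0//.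
apply: (@le_trans _ _ (\sum_(i < m) `|y i| `^ q0 * M `^ (q%:R - q0))).
  by apply: ler_sum.
rewrite -mulr_suml -/S (@le_trans _ _ (M `^ q0 * M `^ (q%:R - q0)))//.
  by rewrite ler_wpM2r// powR_ge0.
rewrite -powRD ?subrKC ?powR_mulrn//.
by rewrite (gt_eqF (lt_le_trans ltr01 M1)) implybT.
Qed.

Lemma bop_sumE (V W : normedModType R) (I : Type) (r : seq I) (Q : pred I)
    (f : I -> bop V W) v :
  (\sum_(i <- r | Q i) f i) v = \sum_(i <- r | Q i) f i v.
Proof. by elim/big_rec2: _ => // i w h _ <-; rewrite bopDE. Qed.

Definition unit_ball (V : normedModType R) := {v : V | `|v| <= 1}.

Lemma dual_lincombE (V : normedModType R) (N : nat) (phi : 'I_N -> dual V)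
    (x : 'I_N -> R) (v : V) :
  (\sum_(k < N) x k *: phi k) v = \sum_(k < N) x k * phi k v.
Proof. exact: bop_sumE. Qed.

(** Cotype is applied to the images of the vectors of [s] under x |-> sum_k x_k phi_k. A signed sum
    of these images is the image of a vector with coordinates bounded by 1, by admissibility of [s],
    so all sign averages are at most 1. *)
Lemma cotype_power_summing (V : normedModType R) (q0 C : R) (q N : nat)
    (phi : 'I_N -> dual V) : 0 < q0 -> q0 <= q.+1%:R -> odd q ->
  (forall n (x : 'I_n -> dual V),
    (\sum_(i < n) `|x i| `^ q0) `^ q0^-1 <= C * rademacher_L2 x) ->
  (forall x : 'I_N -> R, (forall k, `|x k| <= 1) ->
    `|\sum_(k < N) x k *: phi k| <= 1) ->
  power_summing (fun k (v : unit_ball V) => phi k (val v)) q.+1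
    (Num.max 1 C ^+ q.+1).
Proof.
move=> q00 q0q oq cot phi1 s s1.
rewrite big_tnth; pose p i := tnth (in_tuple s) i.
pose y i : dual V := \sum_(k < N) (p i).1 k *: phi k.
apply: le_trans (cotype_sum_norm_le q00 q0q (cot _ y) _).
  apply: ler_sum => i _.
  apply: (@le_trans _ _ (`|y i (val (p i).2)| ^+ q.+1)).
    rewrite -normrX ger0_norm ?exprn_even_ge0//= ?oq//.
    by rewrite /y dual_lincombE.
  rewrite lerXn2r ?nnegrE// (le_trans (bop_normP _ _))//.
  by rewrite ler_piMr ?bop_norm_ge0// (valP (p i).2).
move=> eps.
have -> : \sum_i (-1) ^+ eps i *: y i =
    \sum_(k < N) (\sum_i (-1) ^+ eps i * (p i).1 k) *: phi k.
  under eq_bigr do rewrite scaler_sumr.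
  rewrite exchange_big/=; apply: eq_bigr => k _.
  by rewrite scaler_suml; apply: eq_bigr => i _; rewrite scalerA.
apply: phi1 => k; apply: le_trans (s1 k); rewrite [leRHS]big_tnth.
apply: le_trans (ler_norm_sum _ _ _) _; apply: ler_sum => i _.
by rewrite normrM normrX normrN1 expr1n mul1r.
Qed.

End cotype_power_summing.

(** * Gaussian sums and the one-summing norm *)

Section ell2_operators.
Context {R : realType} {X : normedModType R}.

Lemma sum_sqr_ell2_le (n : nat) (a : ell2 R) :
  \sum_(j < n) a j ^+ 2 <= `|a| ^+ 2.
Proof.
rewrite (_ : `|a| = ell2_norm a)// sqr_ell2_norm; last exact: (@ell2P _ a).
have := sqsum_le_lim n (@ell2P _ a).
by rewrite /sqsum seriesEnat/= big_mkord.
Qed.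

Lemma ell2_coord_le (a : ell2 R) (j : nat) : `|a j| <= `|a|.
Proof.
rewrite -(@ler_pXn2r _ 2) ?nnegrE// (le_trans _ (sum_sqr_ell2_le j.+1 a))//.
rewrite -normrX ger0_norm ?sqr_ge0// big_ord_recr/= lerDr.
by rewrite sumr_ge0// => i _; exact: sqr_ge0.
Qed.

Lemma ell2_lincomb_subproof (n : nat) (x : nat -> X) :
  (fun a : ell2 R => \sum_(j < n) a j *: x j) \in @bop_pred R (ell2 R) X.
Proof.
apply/mem_set; split.
  move=> c a b; rewrite scaler_sumr -big_split/=; apply: eq_bigr => j _.
  by rewrite scalerA -scalerDl.
exists (\sum_(j < n) `|x j|) => a.
rewrite (le_trans (ler_norm_sum _ _ _))// mulr_suml.
apply: ler_sum => j _; rewrite normrZ mulrC ler_wpM2l//.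
exact: ell2_coord_le.
Qed.

Definition ell2_lincomb (n : nat) (x : nat -> X) : bop (ell2 R) X :=
  Bop (ell2_lincomb_subproof n x).

Lemma ell2_lincomb_finite_rank n x : finite_rank (ell2_lincomb n x).
Proof. by exists n, (fun j => x j) => a; exists (fun j => a j). Qed.

Lemma ell2_lincomb_basis n x j :
  ell2_lincomb n x (ell2_basis j) = if (j < n)%N then x j else 0.
Proof.
rewrite /ell2_lincomb/=; case: ifPn => [jn|jn].
  rewrite (bigD1 (Ordinal jn))//= eqxx scale1r big1 ?addr0// => i.
  by rewrite -val_eqE/= => /negPf ->; rewrite scale0r.
rewrite big1// => i _; rewrite ltn_eqF ?scale0r//.
by rewrite (leq_trans (ltn_ord i))// leqNgt.
Qed.

End ell2_operators.

Section L2_norm.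
Context {R : realType} {d : measure_display} {Omega : measurableType d}.
Context {P : probability Omega R} {X : normedModType R}.
Implicit Types f h : Omega -> X.

Lemma L2_norm_ge0 f : (0 <= L2_norm P f)%E.
Proof. exact: Lnorm_ge0. Qed.

Lemma Lnorm2E (u : Omega -> R) :
  ('N[P]_2%:E[(fun t => (u t)%:E)] = (\int[P]_t (u t ^+ 2)%:E) `^ 2^-1)%E.
Proof.
rewrite unlock; congr (_ `^ _)%E; apply: eq_integral => t _.
by rewrite abse_EFin poweR_EFin powR_mulrn// -normrX ger0_norm// sqr_ge0.
Qed.

Lemma sqr_L2_norm f :
  (L2_norm P f `^ 2 = \int[P]_t (`|f t| ^+ 2)%:E)%E.
Proof.
rewrite /L2_norm poweR_Lnorm//; apply: eq_integral => t _.
by rewrite abse_EFin normr_id poweR_EFin powR_mulrn.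
Qed.

Lemma L2_norm_lty f :
  (\int[P]_t (`|f t| ^+ 2)%:E < +oo)%E -> (L2_norm P f < +oo)%E.
Proof.
by rewrite -sqr_L2_norm; apply: lty_poweRy; rewrite pnatr_eq0.
Qed.

Lemma L2_norm_fin f : L2 P f -> exists2 L : R, 0 <= L /\ L2_norm P f = L%:E &
  (\int[P]_t (`|f t| ^+ 2)%:E = (L ^+ 2)%:E)%E.
Proof.
move=> [_ Lf]; exists (fine (L2_norm P f)).
  by rewrite fine_ge0 ?L2_norm_ge0// fineK// ge0_fin_numE ?L2_norm_ge0.
rewrite -sqr_L2_norm -[X in (X `^ 2)%E]fineK ?ge0_fin_numE ?L2_norm_ge0//.
by rewrite poweR_EFin powR_mulrn// fine_ge0// L2_norm_ge0.
Qed.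

(** Minkowski for the scalar functions |f| and |h|, after the pointwise triangle inequality. *)
Lemma ler_L2_normD f h : strongly_measurable f -> strongly_measurable h ->
  (L2_norm P (fun t => f t + h t)%R <= L2_norm P f + L2_norm P h)%E.
Proof.
move=> mf mh.
have m f' : strongly_measurable f' -> measurable_fun setT (fun t => `|f' t|).
  exact: measurable_norm_strongly_measurable.
apply: le_trans (minkowski_EFin P (m _ mf) (m _ mh) _); last by rewrite ler1n.
have mD : measurable_fun setT (fun t => `|f t| + `|h t|).
  by apply: measurable_funD; exact: m.
rewrite /L2_norm !Lnorm2E gt0_ler_poweR ?invr_ge0//.
- by rewrite in_itv/= leey andbT integral_ge0// => t _; rewrite lee_fin sqr_ge0.
- by rewrite in_itv/= leey andbT integral_ge0// => t _; rewrite lee_fin sqr_ge0.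
apply: ge0_le_integral => //.
- by apply/measurable_EFinP/measurable_funX/m; exact: strongly_measurableD.
- exact/measurable_EFinP/measurable_funX.
- by move=> t _; rewrite lee_fin lerXn2r ?nnegrE ?addr_ge0 ?ler_normD.
Qed.

End L2_norm.

Section gaussian_sums.
Context {R : realType} {d : measure_display} {Omega : measurableType d}.
Context {P : probability Omega R} {g : nat -> {RV P >-> R}}.
Context {X : normedModType R}.

(** [g j] is the Gaussian sum whose coefficients form a unit vector, so the moment bound with p = 2
    applies. *)
Lemma gaussian_sqr_integral_lty (j : nat) : gaussian_sequence g ->
  (\int[P]_t (g j t ^+ 2)%:E < +oo)%E.
Proof.
move=> hg; pose a (i : nat) : R := (i == j)%:R.
have aj (F : nat -> R) : \sum_(i < j.+1) a i * F i = F j.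
  rewrite (bigD1 ord_max)//= /a eqxx mul1r big1 ?addr0// => i.
  by rewrite -val_eqE/= => /negPf ->; rewrite mul0r.
have a1 : \sum_(i < j.+1) a i ^+ 2 <= 1.
  by under eq_bigr do rewrite expr2; rewrite (aj a) /a eqxx.
have := gaussian_sum_moment_le (p := 2) hg isT a1.
under eq_integral => t _ do rewrite (aj (fun i => g i t)).
by move=> /le_lt_trans; apply; rewrite ltry.
Qed.

Lemma L2_gaussian_sum (n : nat) (x : nat -> X) : gaussian_sequence g ->
  L2 P (fun t => \sum_(j < n) g j t *: x j).
Proof.
move=> hg.
have ms j : strongly_measurable (fun t => g j t *: x j).
  by apply: strongly_measurableZ => //; exact: strongly_measurable_cst.
split; first exact: (strongly_measurable_sum n ms).
elim: n => [|n IH].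
  apply: L2_norm_lty; under eq_integral do rewrite big_ord0 normr0 expr0n.
  by rewrite integral0.
under eq_fun do rewrite big_ord_recr/=.
have m1 := strongly_measurable_sum n ms.
apply: le_lt_trans (ler_L2_normD m1 (ms n)) _.
rewrite lte_add_pinfty//; apply: L2_norm_lty.
under eq_integral do rewrite normrZ exprMn mulrC EFinM.
rewrite ge0_integralZl//; last first.
  by apply/measurable_EFinP/measurable_funX; exact: measurableT_comp.
under eq_integral do rewrite -normrX ger0_norm ?sqr_ge0//.
by rewrite lte_mul_pinfty ?lee_fin ?sqr_ge0// gaussian_sqr_integral_lty.
Qed.

(** The partial sums of the series equal the finite sum [S] from index n on, so [S] is a limit. The
    chosen limit [gaussian_series] is then at L_2 distance 0 from [S], and the triangle inequality
    concludes. *)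
Lemma L2_norm_le_ell_norm (n : nat) (x : nat -> X) : gaussian_sequence g ->
  (L2_norm P (fun t => \sum_(j < n) g j t *: x j)%R <=
   ell_norm g (ell2_lincomb n x))%E.
Proof.
move=> hg; set T := ell2_lincomb n x; pose S t := \sum_(j < n) g j t *: x j.
have L2S : L2 P S by exact: L2_gaussian_sum.
have ST m t : (n <= m)%N -> \sum_(j < m) g j t *: T (ell2_basis j) = S t.
  move=> nm; rewrite /S (big_ord_widen m (fun j => g j t *: x j))//.
  rewrite [RHS]big_mkcond; apply: eq_bigr => j _; rewrite /T ell2_lincomb_basis.
  by case: ifP => // _; rewrite scaler0.
have cvgS h : L2_norm P (fun t => h t - \sum_(j < m) g j t *: T (ell2_basis j))
    @[m --> \oo] --> L2_norm P (fun t => h t - S t).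
  apply: cvg_near_cst; exists n => // m /= nm.
  by congr (L2_norm P _); apply/funext => t; rewrite ST.
have gS : is_gaussian_series g T S.
  split=> //; suff <- : L2_norm P (fun t => S t - S t) = 0%E by exact: cvgS.
  apply/eqP; rewrite eq_le L2_norm_ge0 andbT.
  under eq_fun do rewrite subrr.
  rewrite /L2_norm Lnorm2E; under eq_integral do rewrite normr0 expr0n.
  by rewrite integral0 poweR0r// invr_eq0 pnatr_eq0.
have [[mh _] hS] : is_gaussian_series g T (gaussian_series g T).
  by apply: xgetPex; exists S.
set h := gaussian_series g T in mh hS *.
have h0 : L2_norm P (fun t => h t - S t) = 0%E :=
  cvg_unique (@ereal_hausdorff R) (cvgS h) hS.
rewrite /ell_norm -/h -[leRHS]adde0 -h0.
have -> : L2_norm P (fun t => h t - S t) = L2_norm P (fun t => S t - h t).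
  by congr Lnorm; apply/funext => t; rewrite distrC.
apply: le_trans (ler_L2_normD mh (strongly_measurableB L2S.1 mh)).
by under [in leRHS]eq_fun do rewrite subrKC.
Qed.

(** This is (1 + c2) / 2, where c2 bounds the mean of the quadratic majorant of the pairing and [A]
    bounds the mass of the weights. It is the value of the AM-GM bound L^2 / (2s) + s c2 / 2 at s =
    L, divided by L. *)
Definition pairing_const (q : nat) (D : R) : R :=
  let A := q.+1%:R * (2 * D) + 1 in
  (1 + (2 * A ^+ 2 + 8 * (1 + A * gaussian_moment_bound q.+1.*2))) / 2.

(** The domination at y_k = G_k(t) gives |sum_k G_k phi_k(f)|^2 <= |f|^2 Q, with [Q] involving only
    powers of single G_k. Its mean is therefore bounded by single moments and the total mass of the
    weights, uniformly in n and N. *)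
Lemma gaussian_pairing_le (q n N : nat) (D L : R) (a : 'I_N -> nat -> R)
    (phi : 'I_N -> dual X) (f : Omega -> X) :
  gaussian_sequence g -> odd q -> 0 <= D ->
  power_summing (fun k (v : unit_ball X) => phi k (val v)) q.+1 D ->
  (forall k, \sum_(j < n) a k j ^+ 2 <= 1) ->
  strongly_measurable f -> 0 <= L ->
  (\int[P]_t (`|f t| ^+ 2)%:E = (L ^+ 2)%:E)%E ->
  (\int[P]_t (`|\sum_(k < N) (\sum_(j < n) a k j * g j t) * phi k (f t)|)%:E
   <= (pairing_const q D * L)%:E)%E.
Proof.
move=> hg oq D0 sD a1 mf L0 fL.
have [mu [mu0 smu muP]] := power_summing_sqr_le oq D0 sD.
set A := _ + 1 in smu muP.
have A0 : 0 <= A by rewrite addr_ge0// !mulr_ge0.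
pose G k t := \sum_(j < n) a k j * g j t.
pose Q t := 2 * A ^+ 2 + 8 * (1 + \sum_(k < N) mu k * G k t ^+ q.+1.*2).
pose c2 := 2 * A ^+ 2 + 8 * (1 + A * gaussian_moment_bound q.+1.*2).
have mG k : measurable_fun setT (G k) by exact: measurable_gaussian_sum.
have G0 k t : 0 <= G k t ^+ q.+1.*2 by rewrite exprn_even_ge0// odd_double.
have mQ : measurable_fun setT Q.
  apply: measurable_funD => //; apply: measurable_funM => //.
  apply: measurable_funD => //; apply: measurable_sum => k.
  by apply: measurable_funM => //; exact: measurable_funX.
have Q0 t : 0 <= Q t.
  rewrite addr_ge0 ?mulr_ge0 ?sqr_ge0// addr_ge0// sumr_ge0// => k _.
  by rewrite mulr_ge0.
(* The domination is available on the unit ball only, hence the normalisation of [f t]. *)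
have u_sqr t : (\sum_(k < N) G k t * phi k (f t)) ^+ 2 <= `|f t| ^+ 2 * Q t.
  have [->|ft0] := eqVneq (f t) 0.
    rewrite big1 ?expr0n/= ?mulr_ge0 ?sqr_ge0// => k _.
    by rewrite linear0 mulr0.
  have nf0 : 0 < `|f t| by rewrite normr_gt0.
  have v1 : `| `|f t|^-1 *: f t| <= 1.
    by rewrite normrZ normfV normr_id mulVf// gt_eqF.
  have := muP (G ^~ t) (exist _ (`|f t|^-1 *: f t) v1 : unit_ball X).
  rewrite /pairing/= -/(Q t).
  have -> : \sum_(k < N) G k t * phi k (`|f t|^-1 *: f t) =
      `|f t|^-1 * \sum_(k < N) G k t * phi k (f t).
    by rewrite mulr_sumr; apply: eq_bigr => k _; rewrite linearZ/= mulrCA.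
  by rewrite exprMn exprVn ler_pdivrMl// exprn_gt0.
have IQ : (\int[P]_t (Q t)%:E <= c2%:E)%E.
  rewrite /c2; set M := gaussian_moment_bound _.
  have IG k : (\int[P]_t (G k t ^+ q.+1.*2)%:E <= M%:E)%E.
    by apply: gaussian_sum_moment_le => //; rewrite odd_double.
  have M0 : 0 <= M.
    by rewrite !mulr_ge0// expR_ge0.
  have mGk k : measurable_fun setT (fun t => (mu k * G k t ^+ q.+1.*2)%:E).
    by apply/measurable_EFinP/measurable_funM => //; exact: measurable_funX.
  have mS : measurable_fun setT (fun t => (\sum_(k < N) mu k * G k t ^+ q.+1.*2)%:E).
    by under eq_fun do rewrite -sumEFin; exact: emeasurable_sum.
  have S0 t : 0 <= \sum_(k < N) mu k * G k t ^+ q.+1.*2.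
    by apply: sumr_ge0 => k _; rewrite mulr_ge0.
  have IS : (\int[P]_t (\sum_(k < N) mu k * G k t ^+ q.+1.*2)%:E <= (A * M)%:E)%E.
    under eq_integral do rewrite -sumEFin.
    rewrite ge0_integral_sum//; last by move=> k t _; rewrite lee_fin mulr_ge0.
    apply: (@le_trans _ _ (\sum_(k < N) (mu k * M)%:E)%E).
      apply: lee_sum => k _; under eq_integral do rewrite EFinM.
      rewrite ge0_integralZl//; last 3 first.
      - by apply/measurable_EFinP; exact: measurable_funX.
      - by move=> t _; rewrite lee_fin.
      - by rewrite lee_fin.
      by rewrite EFinM lee_wpmul2l// lee_fin.
    by rewrite sumEFin lee_fin -mulr_suml ler_wpM2r.
  have EP (c : R) : (\int[P]_t c%:E = c%:E)%E.
    by rewrite integral_cst//= probability_setT mule1.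
  rewrite (_ : (\int[P]_t (Q t)%:E = \int[P]_t ((2 * A ^+ 2)%:E +
    8%:E * (1%:E + (\sum_(k < N) mu k * G k t ^+ q.+1.*2)%:E)))%E)//.
  rewrite ge0_integralD//; last 3 first.
  - by rewrite lee_fin mulr_ge0// sqr_ge0.
  - by move=> t _; rewrite -EFinD -EFinM lee_fin mulr_ge0// addr_ge0.
  - by apply: measurable_funeM; exact: emeasurable_funD.
  rewrite EP.
  rewrite ge0_integralZl//; last 2 first.
  - exact: emeasurable_funD.
  - by move=> t _; rewrite -EFinD lee_fin addr_ge0.
  rewrite ge0_integralD//; last by move=> t _; rewrite lee_fin.
  rewrite (EP 1).
  rewrite [leRHS]EFinD leeD// [leRHS]EFinM lee_wpmul2l ?lee_fin//.
  by rewrite EFinD leeD.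
have c20 : 0 <= c2.
  by rewrite -lee_fin (le_trans _ IQ)// integral_ge0// => t _; rewrite lee_fin.
have mf2 : measurable_fun setT (fun t => `|f t| ^+ 2).
  by apply: measurable_funX; exact: measurable_norm_strongly_measurable.
pose u t := \sum_(k < N) G k t * phi k (f t).
have mu_ : measurable_fun setT u.
  apply: measurable_sum => k; apply: measurable_funM => //.
  by apply: measurable_comp_strongly_measurable mf; exact: bop_continuous.
(* AM-GM: [|u| <= |f| sqrt Q <= (|f|^2 / s + s Q) / 2] *)
have amgm s t : 0 < s -> `|u t| <= (2 * s)^-1 * `|f t| ^+ 2 + s / 2 * Q t.
  move=> s0; rewrite -(@ler_pXn2r _ 2) ?nnegrE//; last first.
    by rewrite addr_ge0 ?mulr_ge0 ?invr_ge0 ?mulr_ge0 ?sqr_ge0 ?(ltW s0).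
  rewrite -normrX ger0_norm ?sqr_ge0// (le_trans (u_sqr t))//.
  rewrite -subr_ge0 [leRHS](_ : _ =
    ((2 * s)^-1 * `|f t| ^+ 2 - s / 2 * Q t) ^+ 2) ?sqr_ge0//.
  by field; exact: lt0r_neq0.
have H s : 0 < s ->
    (\int[P]_t (`|u t|)%:E <= ((2 * s)^-1 * L ^+ 2 + s / 2 * c2)%:E)%E.
  move=> s0; have i0 : 0 <= (2 * s)^-1 by rewrite invr_ge0 mulr_ge0// ltW.
  have i1 : 0 <= s / 2 by rewrite divr_ge0// ltW.
  apply: (@le_trans _ _ (\int[P]_t
      (((2 * s)^-1)%:E * (`|f t| ^+ 2)%:E + (s / 2)%:E * (Q t)%:E))%E).
    apply: ge0_le_integral => //.
    - by apply/measurable_EFinP; exact: measurableT_comp.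
    - by apply/measurable_EFinP; apply: measurable_funD; exact: measurable_funM.
    - by move=> t _; rewrite lee_fin; exact: amgm.
  rewrite ge0_integralD//; last 4 first.
  - by move=> t _; rewrite lee_fin mulr_ge0// sqr_ge0.
  - by apply/measurable_EFinP; exact: measurable_funM.
  - by move=> t _; rewrite lee_fin mulr_ge0.
  - by apply/measurable_EFinP; exact: measurable_funM.
  rewrite !ge0_integralZl//; try exact/measurable_EFinP.
  - by rewrite fL EFinD EFinM leeD2l// [leRHS]EFinM lee_wpmul2l.
  - by move=> t _; rewrite lee_fin.
apply/lee_addgt0Pr => e e0; rewrite -EFinD.
pose c := pairing_const q D.
have c0 : 0 < c by rewrite divr_gt0// ltr_wpDr.
(* The natural choice s = L may vanish; the shift makes [s] positive and costs exactly [e], since c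
   s = c L + e. *)
pose s := L + e / c.
have s0 : 0 < s by rewrite ltr_wpDl// divr_gt0.
apply: le_trans (H s s0) _; rewrite lee_fin -/c.
have -> : c * L + e = c * s by rewrite /s mulrDr mulrCA divff ?mulr1// gt_eqF.
have -> : c = (1 + c2) / 2 by [].
apply: (@le_trans _ _ ((2 * s)^-1 * s ^+ 2 + s / 2 * c2)).
  rewrite lerD2r ler_wpM2l ?invr_ge0 ?mulr_ge0 ?(ltW s0)//.
  by rewrite lerXn2r ?nnegrE ?(ltW s0)// lerDl divr_ge0 ?ltW.
rewrite le_eqVlt; apply/orP; left; apply/eqP; field; exact: lt0r_neq0.
Qed.

End gaussian_sums.

(** * Evaluation functionals, weak l_1 norms and almost norming vectors *)

Section evaluation.
Context {R : realType} {X : normedModType R}.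

Lemma dual_eval_subproof (z : X) :
  (fun phi : dual X => phi z : R^o) \in @bop_pred R (dual X) R^o.
Proof.
apply/mem_set; split => [a phi psi|]; first by rewrite bopDE bopZE.
by exists `|z| => phi; rewrite mulrC; exact: bop_normP.
Qed.

Definition dual_eval (z : X) : dual (dual X) := Bop (dual_eval_subproof z).

Lemma dual_eval_norm_le (z : X) : `|dual_eval z| <= `|z|.
Proof.
apply: bop_norm_le => phi phi1 /=; rewrite (le_trans (bop_normP _ _))//.
by rewrite ler_piMl.
Qed.

(** The weak l_1 norm of functionals is a supremum over the unit ball of the bidual. The canonical
    image of the unit ball of X lies in it, which gives the bound on the combinations; finiteness
    comes from the sum of the norms. *)
Lemma weak_l1_norm_fin (N : nat) (phi : 'I_N -> dual X) :
  exists w : R, [/\ 0 <= w, weak_l1_norm phi = w%:E &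
    forall x : 'I_N -> R, (forall k, `|x k| <= 1) ->
      `|\sum_(k < N) x k *: phi k| <= w].
Proof.
pose S := [set (\sum_(k < N) `|xi (phi k)|)%:E |
  xi in [set xi : dual (dual X) | `|xi| <= 1]].
have S0 : (0 <= ereal_sup S)%E.
  apply: ereal_sup_ubound; exists 0; first by rewrite /= normr0.
  by rewrite big1// => k _; rewrite (_ : (0 : dual (dual X)) _ = 0) ?normr0.
have Sfin : (ereal_sup S <= (\sum_(k < N) `|phi k|)%:E)%E.
  apply: ge_ereal_sup => _ [xi /= xi1 <-]; rewrite lee_fin.
  apply: ler_sum => k _; rewrite (le_trans (bop_normP _ _))//.
  by rewrite ler_piMl.
have SE : ereal_sup S \is a fin_num.
  by rewrite ge0_fin_numE// (le_lt_trans Sfin)// ltry.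
exists (fine (ereal_sup S)); split.
- exact: fine_ge0.
- by rewrite /weak_l1_norm fineK.
move=> x x1; apply: bop_norm_le => z z1.
rewrite dual_lincombE -lee_fin fineK//.
apply: (@le_trans _ _ (\sum_(k < N) `|phi k z|)%:E).
  rewrite lee_fin (le_trans (ler_norm_sum _ _ _))//; apply: ler_sum => k _.
  by rewrite normrM ler_piMl.
apply: ereal_sup_ubound; exists (dual_eval z) => //=.
exact: le_trans (dual_eval_norm_le z) z1.
Qed.

End evaluation.

Lemma dual_norm_approx (R : realType) (V : normedModType R) (phi : dual V) (e : R) :
  0 < e -> exists2 v : V, `|v| <= 1 & `|phi| - e <= phi v.
Proof.
move=> e0; have [_ [v v1 <-] /ltW pv] := sup_adherent e0 (bop_has_sup phi).
have [pv0|pv0] := leP 0 (phi v : R); first by exists v => //; rewrite ger0_norm in pv.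
exists (- v); first by rewrite normrN.
by rewrite linearN; move: pv; rewrite ltr0_norm.
Qed.

(** * The one-summing norm of the adjoint of e_j |-> E[g_j f] *)

Section pi1_adjoint.
Context {R : realType} {d : measure_display} {Omega : measurableType d}.
Context {P : probability Omega R} {g : nat -> {RV P >-> R}}.
Context {X : normedModType R}.
Context (f : Omega -> X) (L : R).
Context (hg : gaussian_sequence g) (mf : strongly_measurable f) (L0 : 0 <= L).
Context (fL : (\int[P]_t (`|f t| ^+ 2)%:E = (L ^+ 2)%:E)%E).

Let x j := bochner_integral P (fun t => g j t *: f t).

(** Dominated by ||phi|| (g_j^2 + |f|^2), as |g_j| |f| <= g_j^2 + |f|^2. *)
Lemma gaussian_functional_integrable (j : nat) (phi : dual X) :
  P.-integrable setT (fun t => (phi (g j t *: f t))%:E).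
Proof.
have mgf : strongly_measurable (fun t => g j t *: f t).
  exact: strongly_measurableZ.
have mn : measurable_fun setT (fun t => `|f t| ^+ 2).
  by apply: measurable_funX; exact: measurable_norm_strongly_measurable.
have mg2 : measurable_fun setT (fun t => g j t ^+ 2) by exact: measurable_funX.
have mp : measurable_fun setT (fun t => phi (g j t *: f t)).
  by apply: measurable_comp_strongly_measurable mgf; exact: bop_continuous.
have i2 : P.-integrable setT (fun t => (bop_norm phi)%:E *
    ((g j t ^+ 2)%:E + (`|f t| ^+ 2)%:E))%E.
  apply: integrableZl => //; apply: integrableD => //; apply/integrableP; split.
  - exact/measurable_EFinP.
  - under eq_integral do rewrite abse_EFin ger0_norm ?sqr_ge0//.
    exact: gaussian_sqr_integral_lty.
  - exact/measurable_EFinP.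
  - under eq_integral do rewrite abse_EFin ger0_norm ?sqr_ge0//.
    by rewrite fL ltry.
apply: le_integrable i2 => //; first exact/measurable_EFinP.
move=> t _; rewrite -EFinD -EFinM !abse_EFin lee_fin [leRHS]ger0_norm; last first.
  by rewrite mulr_ge0 ?bop_norm_ge0// addr_ge0// sqr_ge0.
rewrite (le_trans (bop_normP _ _))// ler_wpM2l ?bop_norm_ge0// normrZ.
rewrite -[g j t ^+ 2]ger0_norm ?sqr_ge0// normrX.
have := sqr_ge0 (`|g j t| - `|f t|); have := sqr_ge0 (`|g j t| + `|f t|).
have := normr_ge0 (g j t); have := normr_ge0 (f t).
nra.
Qed.

(** Pulling phi_k through the Bochner integrals turns the left side into the mean of sum_k G_k
    phi_k(f), where G_k is the Gaussian sum with coefficients [b k]; this is the quantity bounded by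
    [gaussian_pairing_le]. *)
Lemma sum_functional_lincomb_le (q n N : nat) (D : R) (phi : 'I_N -> dual X)
    (a : 'I_N -> ell2 R) : odd q -> 0 <= D ->
  power_summing (fun k (v : unit_ball X) => phi k (val v)) q.+1 D ->
  (forall k, `|a k| <= 1) ->
  \sum_(k < N) phi k (ell2_lincomb n x (a k)) <= pairing_const q D * L.
Proof.
move=> oq D0 sD a1.
pose B j := exists v, has_bochner_integral P (fun t => g j t *: f t) v.
(* [bochner_integral] is 0 when the Bochner integral does not exist, so the
   corresponding coefficients may be dropped; existence is never needed. *)
pose b k j := if `[< B j >] then a k j else 0.
have b1 k : \sum_(j < n) b k j ^+ 2 <= 1.
  apply: le_trans (_ : _ <= `|a k| ^+ 2) _; last by rewrite exprn_ile1.
  apply: le_trans (sum_sqr_ell2_le n (a k)); apply: ler_sum => j _.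
  by rewrite /b; case: ifP => // _; rewrite expr0n sqr_ge0.
have bi k j : P.-integrable setT (fun t => (b k j * phi k (g j t *: f t))%:E).
  under eq_fun do rewrite EFinM.
  by apply: integrableZl => //; exact: gaussian_functional_integrable.
have bE k j : (a k j * phi k (x j))%:E =
    (\int[P]_t (b k j * phi k (g j t *: f t))%:E)%E.
  under eq_integral do rewrite EFinM.
  rewrite integralZl//; last exact: gaussian_functional_integrable.
  rewrite /b; case: asboolP => [Bj|nB].
    have xj : has_bochner_integral P (fun t => g j t *: f t) (x j).
      exact: xgetPex.
    rewrite (has_bochner_integral_functional xj) ?EFinM//.
    exact: gaussian_functional_integrable.
  rewrite mul0e /x /bochner_integral xgetPN ?linear0 ?mulr0//.
  by move=> v vB; apply: nB; exists v.
rewrite -lee_fin.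
have -> : (\sum_(k < N) phi k (ell2_lincomb n x (a k)))%:E =
    (\int[P]_t (\sum_(k < N) (\sum_(j < n) b k j * g j t) * phi k (f t))%:E)%E.
  rewrite -sumEFin.
  under eq_bigr do rewrite linear_sum -sumEFin.
  transitivity (\sum_(k < N) \sum_(j < n)
      \int[P]_t (b k j * phi k (g j t *: f t))%:E)%E.
    apply: eq_bigr => k _; apply: eq_bigr => j _.
    by rewrite -bE linearZ.
  under eq_bigr do rewrite -integral_sum//.
  rewrite -integral_sum//; last by move=> k; exact: integrable_sum.
  apply: eq_integral => t _; rewrite -sumEFin; apply: eq_bigr => k _.
  rewrite sumEFin mulr_suml; congr _%:E; apply: eq_bigr => j _.
  by rewrite linearZ/= mulrA.
apply: le_trans (gaussian_pairing_le hg oq D0 sD b1 mf L0 fL).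
apply: le_trans (lee_abs _) _; apply: le_abse_integral => //.
apply/measurable_EFinP; apply: measurable_sum => k; apply: measurable_funM.
  exact: measurable_gaussian_sum.
by apply: measurable_comp_strongly_measurable mf; exact: bop_continuous.
Qed.

Lemma pi1_norm_adjoint_le (q n : nat) (D : R) : odd q -> 0 <= D ->
  (forall N (phi : 'I_N -> dual X),
    (forall y : 'I_N -> R, (forall k, `|y k| <= 1) ->
       `|\sum_(k < N) y k *: phi k| <= 1) ->
    power_summing (fun k (v : unit_ball X) => phi k (val v)) q.+1 D) ->
  (pi1_norm (adjoint (ell2_lincomb n x)) <= (pairing_const q D * L)%:E)%E.
Proof.
move=> oq D0 sD; set T := ell2_lincomb n x; set c := pairing_const q D.
(* Nonnegativity is the case N = 0 of the preceding bound, whose left side is the empty sum. *)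
have cL0 : 0 <= c * L.
  have -> : 0 = \sum_(k < 0) (0 : dual X) (T 0) :> R by rewrite big_ord0.
  apply: (@sum_functional_lincomb_le q n 0 D (fun=> 0) (fun=> 0)) => //.
    by apply: sD => y _; rewrite big_ord0 normr0.
  by move=> k; rewrite normr0.
apply: ereal_inf_lbound; exists (c * L) => //; split => // N phi.
have [w [w0 -> phiw]] := weak_l1_norm_fin phi.
rewrite -EFinM lee_fin; apply/ler_addgt0Pr => e e0.
(* [e1] serves twice: it keeps the normalising factor w + e1 positive when w = 0, and it is the
   defect of the almost norming vectors. The total error is e1 (c L + N), at most [e]; the summand 1
   keeps the divisor positive. *)
pose e1 := e / (c * L + N%:R + 1).
have s0 : 0 < c * L + N%:R + 1 by rewrite ltr_wpDl// addr_ge0.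
have e10 : 0 < e1 by rewrite divr_gt0.
have we : 0 < w + e1 by rewrite ltr_wpDl.
pose psi k : dual X := (w + e1)^-1 *: phi k.
have psi1 (y : 'I_N -> R) : (forall k, `|y k| <= 1) ->
    `|\sum_(k < N) y k *: psi k| <= 1.
  move=> y1; rewrite /psi; under eq_bigr do rewrite scalerA mulrC -scalerA.
  rewrite -scaler_sumr normrZ gtr0_norm ?invr_gt0// ler_pdivrMl// mulr1.
  by rewrite (le_trans (phiw _ y1))// lerDl ltW.
have /boolp.choice[a aP] (k : 'I_N) : exists v : ell2 R,
    `|v| <= 1 /\ `|adjoint T (phi k)| - e1 <= phi k (T v).
  have [v v1 vP] := dual_norm_approx (adjoint T (phi k)) e10.
  by exists v.
have := sum_functional_lincomb_le n oq D0 (sD _ _ psi1) (fun k => (aP k).1).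
rewrite -/T -/c /psi; under eq_bigr do rewrite bopZE.
rewrite -scaler_sumr ler_pdivrMl// => H.
apply: (@le_trans _ _ (\sum_(k < N) (phi k (T (a k)) + e1))).
  by apply: ler_sum => k _; rewrite -lerBlDr; exact: (aP k).2.
rewrite big_split/= sumr_const card_ord -mulr_natr.
apply: le_trans (lerD H (lexx _)) _.
have -> : (w + e1) * (c * L) + e1 * N%:R = c * L * w + e1 * (c * L + N%:R) by ring.
rewrite lerD2l /e1 mulrAC ler_pdivrMr// ler_wpM2l ?(ltW e0)//.
by rewrite lerDl.
Qed.

End pi1_adjoint.

(** * From GAP and cotype of the dual to K-convexity *)

Theorem corollary1p8 (R : realType) (d : measure_display)
    (Omega : measurableType d) (P : probability Omega R)
    (g : nat -> {RV P >-> R}) (hg : gaussian_sequence g)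
    (X : completeNormedModType R)
    (hGAP : GAP g X) (hcotype : finite_cotype (dual X)) :
  K_convex g X.
Proof.
have [K KP] := hGAP; have [q0 q02 [C CP]] := hcotype.
have q00 : 0 < q0 by exact: lt_le_trans q02.
(* An odd [q], so that the exponent q+1 is even, large enough for q+1 >= q0. *)
pose q := (Num.bound q0).*2.+1.
have oq : odd q by rewrite /= odd_double.
have q0q : q0 <= q.+1%:R.
  rewrite (le_trans (ltW (archi_boundP (ltW q00))))// ler_nat.
  by rewrite /q -addnn -!addnS leq_addr.
pose D := Num.max 1 C ^+ q.+1.
have D0 : 0 <= D by rewrite exprn_ge0// le_max ler01.
(* [K] may be negative; as the one-summing norm is nonnegative, [K] may be replaced by its absolute
   value. *)
exists (`|K| * pairing_const q D) => n f Lf.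
have [L [L0 ->] fL] := L2_norm_fin Lf; have mf := Lf.1.
pose x j := bochner_integral P (fun t => g j t *: f t).
apply: le_trans (L2_norm_le_ell_norm n x hg) _.
apply: le_trans (KP _ (ell2_lincomb_finite_rank n x)) _.
have := pi1_norm_adjoint_le hg mf L0 fL n oq D0
  (fun N phi phi1 => cotype_power_summing q00 q0q oq CP phi1).
move=> H; apply: (@le_trans _ _ (`|K|%:E * pi1_norm (adjoint (ell2_lincomb n x)))%E).
  rewrite lee_wpmul2r// ?lee_fin ?ler_norm//.
  by apply: le_ereal_inf_tmp => _ [c [c0 _] <-]; rewrite lee_fin.
by rewrite -EFinM -mulrA EFinM lee_wpmul2l// lee_fin.
Qed.
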